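(* For $\alpha,\beta\in[0,1]$, define $$\gamma_1=1-\sqrt{\beta(1-\alpha)}-\sqrt{\alpha(1-\beta)},\qquad \gamma_2=1-\sqrt{\beta(1-\alpha)}+\sqrt{\alpha(1-\beta)},$$ $$\gamma_3=1+\sqrt{\beta(1-\alpha)}-\sqrt{\alpha(1-\beta)},\qquad \gamma_4=1+\sqrt{\beta(1-\alpha)}+\sqrt{\alpha(1-\beta)}.$$ The free additive convolution of the Bernoulli distributions $\mathsf{B}(\alpha)$ and $\mathsf{B}(\beta)$ is given by $$\mathsf{B}(\alpha)\boxplus\mathsf{B}(\beta)=\max(1-\alpha-\beta,0)\,\delta_0+|\alpha-\beta|\,\delta_1+\max(\alpha+\beta-1,0)\,\delta_2+\nu,$$ where $\nu$ is the absolutely continuous measure supported on $$[\gamma_1,\min(\gamma_2,\gamma_3)]\cup[\max(\gamma_2,\gamma_3),\gamma_4]$$ with density there given by $$g(t)=\frac{\sqrt{-(t-\gamma_1)(t-\gamma_2)(t-\gamma_3)(t-\gamma_4)}}{\pi t(2-t)|t-1|}.$$ The total mass of $\nu$ equals $2\min(\alpha,\beta,1-\alpha,1-\beta)$.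
   Context: $\mathsf{B}(\alpha)=\alpha\delta_1+(1-\alpha)\delta_0$ is the Bernoulli distribution with parameter $\alpha$, where $\delta_x$ is the Dirac mass at $x$. A $*$-probability space is a pair $(\mathcal{A},\varphi)$ with $\mathcal{A}$ a unital complex $*$-algebra and $\varphi:\mathcal{A}\to\mathbf{C}$ a linear form with $\varphi(a^*a)\geq0$ for all $a\in\mathcal{A}$ and $\varphi(1_{\mathcal{A}})=1$. A compactly supported probability measure $\mu$ on $\mathbf{R}$ is the distribution of a self-adjoint $a\in\mathcal{A}$ if $\int_{\mathbf{R}}x^k\,\mathrm{d}\mu(x)=\varphi(a^k)$ for every integer $k\geq0$. A self-adjoint projection $p\in\mathcal{A}$ with $\varphi(p)=\alpha$ has distribution $\mathsf{B}(\alpha)$. Self-adjoint elements $p,q\in\mathcal{A}$ are free (freely independent) if $\varphi(a_1a_2\cdots a_m)=0$ whenever $m\geq1$, each $a_j$ belongs to the unital subalgebra generated by $p$ or to the one generated by $q$, consecutive $a_j$'s come from different ones of these two subalgebras, and $\varphi(a_j)=0$ for all $j$. The free additive convolution $\mathsf{B}(\alpha)\boxplus\mathsf{B}(\beta)$ is the distribution of $p+q$, where $p$ and $q$ are free self-adjoint projections in a $*$-probability space with distributions $\mathsf{B}(\alpha)$ and $\mathsf{B}(\beta)$ respectively. Densities are with respect to Lebesgue measure; when both intervals in the support are degenerate, $\nu$ is the zero measure. *)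

(* Defs.v *)
From HB Require Import structures.
From mathcomp Require Import all_boot all_order all_algebra.
From mathcomp Require Import all_classical all_reals all_analysis.
From mathcomp Require Import measurable_realfun complex ring lra.

Set Implicit Arguments.
Unset Strict Implicit.
Unset Printing Implicit Defensive.

Import Order.TTheory GRing.Theory Num.Theory.
Import numFieldNormedType.Exports.

Local Open Scope classical_set_scope.
Local Open Scope ring_scope.
Local Open Scope complex_scope.

Section StarProbabilitySpace.

Record starProbSpace (R : realType) := StarProbSpace {
  spsort :> algType R[i];
  star : spsort -> spsort;
  state : {scalar spsort};
  starD : {morph star : x y / x + y};
  starZ : forall (c : R[i]) (x : spsort),
    star (c *: x) = Num.conj c *: star x;
  starM : forall x y : spsort, star (x * y) = star y * star x;
  starK : involutive star;
  (* In the order of R[i], 0 <= z means that z is real and nonnegative. *)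
  state_ge0 : forall x : spsort, 0 <= state (star x * x);
  state1 : state 1 = 1 }.

Variable R : realType.
Implicit Type A : starProbSpace R.

Definition selfadjoint A (x : A) : Prop := star x = x.

Definition projection A (p : A) : Prop := selfadjoint p /\ p * p = p.

Definition compactly_supported (mu : {measure set (measurableTypeR R) -> \bar R}) : Prop :=
  exists K : set R, compact K /\ mu (~` K) = 0%E.

Definition has_distribution A (x : A) (mu : {measure set (measurableTypeR R) -> \bar R}) : Prop :=
  [/\ selfadjoint x,
      mu setT = 1%E,
      compactly_supported mu &
      forall k : nat, state A (x ^+ k) = (\int[mu]_t (t ^+ k))%:C].

Definition gen_subalg A (x : A) : set A :=
  smallest [set S : set A | GRing.subalg_closed [in S]] [set x].

Definition free_pair A (x y : A) : Prop :=
  forall (m : nat) (a : 'I_m.+1 -> A) (side : 'I_m.+1 -> bool),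
    (forall j, gen_subalg (if side j then x else y) (a j)) ->
    (forall i j : 'I_m.+1, j = i.+1 :> nat -> side i != side j) ->
    (forall j, state A (a j) = 0) ->
    state A (\prod_(j < m.+1) a j) = 0.

End StarProbabilitySpace.

Section BernoulliFreeConvolution.
Variable R : realType.

Definition bernoulli (a : {i01 R}) : {measure set (measurableTypeR R) -> \bar R} :=
  measure_add (mscale (a%:num)%:nng \d_(1 : measurableTypeR R))
              (mscale (1 - a%:num)%:nng \d_(0 : measurableTypeR R)).

Definition free_bernoulli_projections (alpha beta : {i01 R})
    (A : starProbSpace R) (p q : A) : Prop :=
  [/\ projection p, projection q,
      has_distribution p (bernoulli alpha),
      has_distribution q (bernoulli beta) & free_pair p q].

(* The law of p + q does not depend on the choice of the free pair (p, q): mu is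
   the free convolution when it is the law of p + q for every such pair, and
   the first component guarantees that such a pair exists. *)
Definition is_bernoulli_free_conv (alpha beta : {i01 R})
    (mu : {measure set (measurableTypeR R) -> \bar R}) : Prop :=
  (exists (A : starProbSpace R) (p q : A),
     free_bernoulli_projections alpha beta p q) /\
  (forall (A : starProbSpace R) (p q : A),
     free_bernoulli_projections alpha beta p q -> has_distribution (p + q) mu).

End BernoulliFreeConvolution.

Section AbsolutelyContinuousPart.
Variable R : realType.
Implicit Types a b t : R.

Definition gamma1 a b : R := 1 - Num.sqrt (b * (1 - a)) - Num.sqrt (a * (1 - b)).
Definition gamma2 a b : R := 1 - Num.sqrt (b * (1 - a)) + Num.sqrt (a * (1 - b)).
Definition gamma3 a b : R := 1 + Num.sqrt (b * (1 - a)) - Num.sqrt (a * (1 - b)).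
Definition gamma4 a b : R := 1 + Num.sqrt (b * (1 - a)) + Num.sqrt (a * (1 - b)).

Definition nu_support a b : set R :=
  `[gamma1 a b, Num.min (gamma2 a b) (gamma3 a b)] `|`
  `[Num.max (gamma2 a b) (gamma3 a b), gamma4 a b].

(* At t = 0, 1, 2 the quotient is 0 by the convention x / 0 = 0; these points
   are Lebesgue-negligible. *)
Definition nu_density a b t : R :=
  Num.sqrt (- ((t - gamma1 a b) * (t - gamma2 a b) *
               (t - gamma3 a b) * (t - gamma4 a b)))
  / (pi * t * (2 - t) * `|t - 1|).

(* When the two intervals are degenerate nu_support is Lebesgue-negligible, so
   this is the zero measure. *)
Definition nu (alpha beta : {i01 R}) (V : set (measurableTypeR R)) :
    \bar R :=
  (\int[lebesgue_measure]_(t in V `&` nu_support alpha%:num beta%:num)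
     (nu_density alpha%:num beta%:num t)%:E)%E.

Lemma measurable_nu_support a b : measurable (nu_support a b).
Proof. by apply: measurableU; exact: measurable_itv. Qed.

Lemma measurable_invr : measurable_fun setT (@GRing.inv R).
Proof.
have mV : measurable_fun (~` [set (0 : R)]) (@GRing.inv R).
  apply: open_continuous_measurable_fun.
    by rewrite openC; exact: closed_eq.
  by move=> t; rewrite inE /= => /eqP t0; exact: inv_continuous.
rewrite -(setvU [set 0 : R]); apply/measurable_funU.
- exact: measurableC.
- exact: measurable_set1.
- by split => //; exact: measurable_fun_set1.
Qed.

Lemma measurable_nu_density a b : measurable_fun setT (nu_density a b).
Proof.
have mB c : measurable_fun setT (fun t : R => t - c).
  by apply: measurable_funB => //; exact: measurable_cst.
apply: (@measurable_funM _ _ _ _ (fun t => Num.sqrt _) (fun t => _^-1)).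
  apply: measurableT_comp.
    by apply: continuous_measurable_fun; exact: sqrt_continuous.
  apply: measurableT_comp => //.
  by do 3!(apply: measurable_funM; last exact: mB).
apply: measurableT_comp; first exact: measurable_invr.
apply: measurable_funM; last by apply: measurableT_comp; [|exact: mB].
apply: measurable_funM => //.
by apply: measurable_funB.
Qed.

Section Measure.
Variables alpha beta : {i01 R}.
Let a := alpha%:num.
Let b := beta%:num.

Let nu_support_sub : nu_support a b `<=` `[0, 2].
Proof.
have [a0 a1] : 0 <= a /\ a <= 1 by split; rewrite /a.
have [b0 b1] : 0 <= b /\ b <= 1 by split; rewrite /b.
have uE : Num.sqrt (b * (1 - a)) ^+ 2 = b * (1 - a).
  by rewrite sqr_sqrtr// mulr_ge0// subr_ge0.
have vE : Num.sqrt (a * (1 - b)) ^+ 2 = a * (1 - b).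
  by rewrite sqr_sqrtr// mulr_ge0// subr_ge0.
have u0 := sqrtr_ge0 (b * (1 - a)); have v0 := sqrtr_ge0 (a * (1 - b)).
rewrite /nu_support /gamma1 /gamma2 /gamma3 /gamma4.
set u := Num.sqrt (b * _) in uE u0 *; set v := Num.sqrt (a * _) in vE v0 *.
have le_mid (x y z : R) : 0 <= x -> 0 <= y -> z ^+ 2 = x * y -> z <= (x + y) / 2.
  move=> x0 y0 zE; have [//|lt_z] := leP z ((x + y) / 2).
  have : ((x + y) / 2) ^+ 2 < z ^+ 2 by rewrite ltr_pXn2r ?nnegrE//; lra.
  by have := sqr_ge0 (x - y); rewrite zE; lra.
have uv : u + v <= 1.
  have := le_mid _ _ _ b0 _ uE; have := le_mid _ _ _ a0 _ vE.
  by rewrite !subr_ge0 => /(_ b1) ? /(_ a1) ?; lra.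
move=> t /= []; rewrite !in_itv/= ?le_min ?ge_max.
  by move=> /and3P[*]; apply/andP; split; lra.
by move=> /andP[/andP[*] *]; apply/andP; split; lra.
Qed.

Let nu_density_ge0 t : nu_support a b t -> (0 <= (nu_density a b t)%:E)%E.
Proof.
move=> /nu_support_sub /=; rewrite in_itv/= => /andP[t0 t2].
by rewrite lee_fin divr_ge0 ?sqrtr_ge0// !mulr_ge0 ?pi_ge0 ?subr_ge0.
Qed.

Let nu0 : nu alpha beta set0 = 0%E.
Proof. by rewrite /nu set0I integral_set0. Qed.

Let nu_ge0 V : (0 <= nu alpha beta V)%E.
Proof. by apply: integral_ge0 => t [_ /nu_density_ge0]. Qed.

Let nu_sigma_additive : semi_sigma_additive (nu alpha beta).
Proof.
move=> F mF tF mUF; rewrite /nu setI_bigcupl ge0_integral_bigcup//; first last.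
- exact: trivIset_setIr.
- by move=> t [k _ [_ /nu_density_ge0]].
- by apply/measurable_EFinP; apply: measurable_funTS; exact: measurable_nu_density.
- by move=> k; apply: measurableI; [exact: mF|exact: measurable_nu_support].
apply: is_cvg_ereal_nneg_natsum_cond => n _ _.
by apply: integral_ge0 => t [_ /nu_density_ge0].
Qed.

HB.instance Definition _ := isMeasure.Build _ _ _ (nu alpha beta)
  nu0 nu_ge0 nu_sigma_additive.

End Measure.

End AbsolutelyContinuousPart.

(* Main.v *)
Require Import Defs.
From HB Require Import structures.
From mathcomp Require Import all_boot all_order all_algebra.
From mathcomp Require Import all_classical all_reals all_analysis.
From mathcomp Require Import measurable_realfun complex ring lra.

(** Write x = p + q - 1 and c = x^2. For two projections, c commutes with p
    and q, so the unital algebra generated by p and q is spanned over the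
    polynomials in c by 1, p, q and pq, and the law of p + q = 1 + x
    is known once the state is known on the c^n and on the c^n x.

    Put U = beta (1 - alpha), V = alpha (1 - beta), U' = alpha beta and
    V' = (1 - alpha)(1 - beta), so that U + V + U' + V' = 1 and UV = U'V'. The
    products of alternating factors p - alpha and q - beta are expressible through
    the Chebyshev-like elements T_0 = 0, T_1 = 1,
    T_(k+2) = (c - U - V) T_(k+1) - UV T_k ([word_odd], [word_even]). Freeness says
    that the state vanishes on these products, which is a linear recursion with
    the solution ([phi_cheb], [phi_cheb_x])
      phi(T_k) = U'^k + V'^k - (-U)^k - (-V)^k  and  phi(T_k x) = U'^k - V'^k.
    As the T_k with k > 0 span the polynomials in c, this fixes all the moments of
    p + q ([cheb_array_ext]).

    On the side of the measure, the substitution t = 1 + sqrt c or 1 - sqrt c with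
    c = U + V + 2 sqrt(UV) cos s and 0 < s < pi turns the density into a multiple
    of sin^2 s / (c (1 - c)) = sin^2 s / c + sin^2 s / (1 - c) and T_k into a
    multiple of sin(k s) / sin s ([integral_nu_angle], [chebr_sin]). Both c and
    1 - c are denominators of Poisson kernels, because 1 - c is
    U' + V' - 2 sqrt(U'V') cos s. Hence ([Rintegral_poisson_chebr])
      int T_(k+1) dnu = 2 (n1 (-n1)^k + n2^(k+1)),
      n1 = min(U, V), n2 = min(U', V').
    For k = 0 this is the total mass. The atom at 1 sits at c = 0 and has
    the mass |U - V|, the atoms at 0 and 2 sit at c = 1, have masses adding up to
    |U' - V'| and differing by U' - V'; there
    (V - U) T_k = (-U)^k - (-V)^k and (U' - V') T_k = U'^k - V'^k. Adding
    everything replaces each minimum by the symmetric expression found above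
    ([free_bernoulli_law_moment]).

    A free pair exists on the pre-Hilbert space whose orthonormal basis consists of
    the alternating words in two letters, with the state given by the empty word
    ([fock_free]). *)

Set Implicit Arguments.
Unset Strict Implicit.
Unset Printing Implicit Defensive.

Import Order.TTheory GRing.Theory Num.Theory.
Import numFieldNormedType.Exports.

Local Open Scope classical_set_scope.
Local Open Scope ring_scope.

(** * Linear identities in modules *)

Section Idealization.
Variables (C : comPzRingType) (M : lmodType C).

(** The square-zero extension of C by M. It is a commutative ring that contains
    M, so that an identity between linear combinations in a module, which [ring]
    does not handle, becomes an identity in a commutative ring. *)
Definition idealization : Type := (C * M)%type.
Implicit Types x y z : idealization.
HB.instance Definition _ := GRing.Zmodule.on idealization.

Let mul x y : idealization := (x.1 * y.1, x.1 *: y.2 + y.1 *: x.2).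

Let mulA : associative mul.
Proof.
move=> x y z; congr pair => /=; first exact: mulrA.
rewrite !scalerDr !scalerA addrA; congr (_ + _ *: _ + _ *: _); last exact: mulrC.
exact: mulrC.
Qed.

Let mulC : commutative mul.
Proof. by move=> x y; rewrite /mul mulrC addrC. Qed.

Let mul1 : left_id (1, 0) mul.
Proof. by case=> a m; rewrite /mul/= mul1r scale1r scaler0 addr0. Qed.

Let mulDl : left_distributive mul +%R.
Proof.
move=> x y z; congr pair => /=; first exact: mulrDl.
by rewrite scalerDl scalerDr addrACA.
Qed.

HB.instance Definition _ :=
  GRing.Zmodule_isComPzRing.Build idealization mulA mulC mul1 mulDl.

Definition scal_of (c : C) : idealization := (c, 0).
Definition vec_of (m : M) : idealization := (0, m).

Lemma scal_ofD : {morph scal_of : x y / x + y}.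
Proof. by move=> x y; congr pair => /=; rewrite addr0. Qed.
Lemma scal_ofN : {morph scal_of : x / - x}.
Proof. by move=> x; congr pair => /=; rewrite oppr0. Qed.
Lemma scal_ofM : {morph scal_of : x y / x * y}.
Proof. by move=> x y; congr pair => /=; rewrite !scaler0 addr0. Qed.
Lemma scal_of1 : scal_of 1 = 1. Proof. by []. Qed.
Lemma scal_of0 : scal_of 0 = 0. Proof. by []. Qed.
Lemma vec_of0 : vec_of 0 = 0. Proof. by []. Qed.
Lemma vec_ofD : {morph vec_of : x y / x + y}.
Proof. by move=> x y; congr pair => /=; rewrite addr0. Qed.
Lemma vec_ofN : {morph vec_of : x / - x}.
Proof. by move=> x; congr pair => /=; rewrite oppr0. Qed.
Lemma vec_ofZ c m : vec_of (c *: m) = scal_of c * vec_of m.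
Proof. by congr pair => /=; rewrite ?mulr0 ?scale0r ?addr0. Qed.
Lemma vec_of_inj : injective vec_of. Proof. by move=> x y []. Qed.

Definition vec_ofE := (vec_ofD, vec_ofN, vec_ofZ, vec_of0,
  scal_ofD, scal_ofN, scal_ofM, scal_of1, scal_of0).
End Idealization.

Ltac linear_ring := apply: vec_of_inj; rewrite !vec_ofE; ring.

(** * Alternating words and Chebyshev elements *)

Lemma nat_ind2 (P : nat -> Prop) :
  P 0%N -> P 1%N -> (forall n, P n -> P n.+1 -> P n.+2) -> forall n, P n.
Proof.
move=> P0 P1 PS n; suff [] : P n /\ P n.+1 by [].
by elim: n => [//|n [Pn Pn1]]; split => //; exact: PS.
Qed.

Section Words.
Variables (C : comNzRingType) (A : algType C).
Variables (L : bool -> A) (s d : bool -> C).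
Hypothesis LL : forall e, L e * L e = s e *: L e + d e *: 1.

Fixpoint word (e : bool) (n : nat) : A :=
  if n is n'.+1 then L e * word (~~ e) n' else 1.

Lemma wordS e n : word e n.+1 = L e * word (~~ e) n.
Proof. by []. Qed.

Lemma word_prod e n : word e n = \prod_(j < n) L (odd j (+) e).
Proof.
elim: n e => [|n IHn] e; first by rewrite big_ord0.
rewrite big_ord_recl /= IHn; congr (_ * _).
by apply: eq_bigr => j _; rewrite addbN addNb.
Qed.

(** When L true and L false are the centered projections, this is
    (p + q - 1)^2 up to a scalar; see [sqr_central]. Writing it in the letters
    makes it symmetric in the two of them. *)
Definition central : A :=
  L false * L true + L true * L false - s true *: L false - s false *: L true
  + (s false * s true) *: 1.

Lemma centralE e : central =
  L e * L (~~ e) + L (~~ e) * L e - s (~~ e) *: L e - s e *: L (~~ e)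
  + (s e * s (~~ e)) *: 1.
Proof. by case: e => //=; rewrite /central; linear_ring. Qed.

Lemma central_mulL e : central * L e =
  L e * L (~~ e) * L e + d e *: L (~~ e) - (d e * s (~~ e)) *: 1.
Proof.
rewrite (centralE e) !(mulrDl, mulNr) -!scalerAl mul1r -(mulrA _ (L e)) LL.
rewrite mulrDr -!scalerAr mulr1; linear_ring.
Qed.

(** The element [central] acts on long words as a shift by two letters plus a
    backward shift: the two letters it adds either extend the word or cancel
    against its first two letters. This is the three-term recursion of [cheb]. *)
Lemma central_word e n : central * word e n.+2 =
  word e n.+4 + (d false * d true) *: word e n.
Proof.
rewrite /= !negbK !mulrA central_mulL.
rewrite !(mulrDl, mulNr) -!scalerAl mul1r LL mulrDl -!scalerAl mul1r.
by case: e; rewrite //= ?mulrA; linear_ring.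
Qed.

(** With w = 2 sqrt D cos x in place of [central], where D is the product of
    the two values of d, this is D^((k-1)/2) sin(k x) / sin x. The index starts
    with the value 0, so that the recursion needs no special first step. *)
Fixpoint cheb (n : nat) : A :=
  match n with
  | 0 => 0
  | 1 => 1
  | (n'.+1 as m).+1 => central * cheb m - (d false * d true) *: cheb n'
  end.

Lemma chebSS n : cheb n.+2 = central * cheb n.+1 - (d false * d true) *: cheb n.
Proof. by []. Qed.

Lemma central_cheb n : GRing.comm central (cheb n).
Proof.
elim/nat_ind2: n => [||n IH0 IH1].
- exact: commr0.
- exact: commr1.
- rewrite chebSS; apply: commrB; first by apply: commrM.
  by rewrite /GRing.comm -scalerAl -scalerAr IH0.
Qed.

(** Both sides satisfy the recursion of [central_word]; this is why the two
    initial cases suffice. *)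
Lemma word_odd e n : word e n.*2.+1 =
  cheb n.+1 * L e - d e *: (cheb n * L (~~ e) - s (~~ e) *: cheb n).
Proof.
elim/nat_ind2: n => [||n IH0 IH1].
- by rewrite /= mul0r !scaler0 subr0 scaler0 subr0 mulr1 mul1r.
- rewrite /= mulr1 scaler0 subr0 negbK mul1r mulr1 central_mulL mulrA; linear_ring.
have -> : word e n.+2.*2.+1 =
    central * word e n.+1.*2.+1 - (d false * d true) *: word e n.*2.+1.
  by rewrite central_word addrK.
rewrite IH0 IH1 (chebSS n.+1) [in RHS](chebSS n).
rewrite !(mulrBr, mulrBl) -!(scalerAr, scalerAl) !(mulrBr, mulrBl).
rewrite -!(scalerAr, scalerAl) !mulrA; linear_ring.
Qed.

(** Only the sum of the two words of a given even length lies in the span of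
    1 and the letters over the polynomials in [central]. *)
Lemma word_even n : word false n.+1.*2 + word true n.+1.*2 =
  cheb n.+1 * (L false * L true + L true * L false) -
  (2 * (d false * d true)) *: cheb n.
Proof.
elim/nat_ind2: n => [||n IH0 IH1].
- by rewrite /= !mulr1 mul1r scaler0 subr0.
- have -> : word false 4 + word true 4 =
     central * (word false 2 + word true 2) - (2 * (d false * d true)) *: 1.
    rewrite mulrDr !central_word /=; linear_ring.
  by rewrite /= !mulr1 scaler0 subr0.
have -> : word false n.+3.*2 + word true n.+3.*2 =
    central * (word false n.+2.*2 + word true n.+2.*2) -
    (d false * d true) *: (word false n.+1.*2 + word true n.+1.*2).
  rewrite mulrDr !central_word; linear_ring.
rewrite IH0 IH1 (chebSS n.+1) [in RHS](chebSS n).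
rewrite !(mulrBr, mulrBl) -!(scalerAr, scalerAl) !mulrA; linear_ring.
Qed.

Lemma cheb_mul_anticomm n :
  cheb n.+1 * (L false * L true + L true * L false) =
  cheb n.+2 + (d false * d true) *: cheb n + s true *: (cheb n.+1 * L false)
  + s false *: (cheb n.+1 * L true) - (s false * s true) *: cheb n.+1.
Proof.
have -> : L false * L true + L true * L false =
  central + s true *: L false + s false *: L true - (s false * s true) *: 1.
  rewrite /central; linear_ring.
rewrite chebSS central_cheb; move: central => w.
rewrite !(mulrDr, mulrBr) mulrN -!scalerAr mulr1; linear_ring.
Qed.

Lemma sqr_central k :
  (L true + L false + k *: 1) * (L true + L false + k *: 1) =
  central + (s true + s false + 2 * k) *: (L true + L false)
  + (d true + d false + k * k - s false * s true) *: 1.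
Proof.
rewrite !(mulrDl, mulrDr) -!(scalerAl, scalerAr) !LL !(mulr1, mul1r) /central.
linear_ring.
Qed.

End Words.

Section FreeMoments.
Variables (C : comNzRingType) (A : algType C) (phi : {scalar A}).
Variables (p q : A) (al be : C).
Hypotheses (pp : p * p = p) (qq : q * q = q) (phi1 : phi 1 = 1).

Definition centered (e : bool) : A := if e then p - al *: 1 else q - be *: 1.
Definition mean_of (e : bool) : C := if e then al else be.
Definition lin_coef e : C := 1 - 2 * mean_of e.
(** A centered projection satisfies the quadratic relation with the linear
    coefficient [lin_coef] and this constant term. *)
Definition variance e : C := mean_of e * (1 - mean_of e).

Lemma centered_sqr e : centered e * centered e = lin_coef e *: centered e + variance e *: 1.
Proof.
case: e; rewrite /centered/lin_coef/variance/mean_of !(mulrBr, mulrBl)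
  -!(scalerAr, scalerAl) !mulr1 mul1r.
- rewrite pp; linear_ring.
- rewrite qq; linear_ring.
Qed.

Hypothesis word0 : forall e n, phi (word centered e n.+1) = 0.

Notation T := (cheb centered lin_coef variance).
Notation w := (central centered lin_coef).

Let U := be * (1 - al).
Let V := al * (1 - be).
Let U' := al * be.
Let V' := (1 - al) * (1 - be).

(** The state of the k-th Chebyshev element; with this indexing it vanishes
    for k = 0, as it should. *)
Definition cheb_mean k : C := U' ^+ k + V' ^+ k - (- U) ^+ k - (- V) ^+ k.

(** The vanishing of the state on the words of even length. *)
Lemma phi_cheb_rec n : phi (T n.+2) = variance false * variance true * phi (T n)
  + lin_coef false * lin_coef true * phi (T n.+1)
  - lin_coef false * phi (T n.+1 * centered true)
  - lin_coef true * phi (T n.+1 * centered false).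
Proof.
have := congr1 phi (word_even centered_sqr n).
rewrite linearD !word0 addr0 cheb_mul_anticomm.
rewrite !(linearB, linearD, linearZ)/= => h.
apply/eqP; rewrite -subr_eq0 [X in _ == X]h; apply/eqP; ring.
Qed.

(** The vanishing of the state on the words of odd length. *)
Lemma phi_cheb_centered_rec e n : phi (T n.+1 * centered e) =
  variance e * (phi (T n * centered (~~ e)) - lin_coef (~~ e) * phi (T n)).
Proof.
have := congr1 phi (word_odd centered_sqr e n).
rewrite word0 !(linearB, linearZ)/= => /esym/eqP.
by rewrite subr_eq0 => /eqP.
Qed.

(** The two recursions determine the sequences from k = 0. The closed forms
    combine the k-th powers of -U and -V, the characteristic roots of the Chebyshev
    recursion at (p + q - 1)^2 = 0, and of U' and V', those at (p + q - 1)^2 = 1. *)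
Lemma phi_cheb k : [/\ phi (T k) = cheb_mean k,
  phi (T k.+1) = cheb_mean k.+1,
  phi (T k * centered true) = U' ^+ k - (- V) ^+ k - al * cheb_mean k &
  phi (T k * centered false) = U' ^+ k - (- U) ^+ k - be * cheb_mean k].
Proof.
rewrite /cheb_mean /U /V /U' /V'.
elim: k => [|k [IH0 IH1 IHt IHf]].
  by rewrite /= !mul0r linear0 phi1 !expr0 !expr1; split; ring.
have rt := phi_cheb_centered_rec true k; have rf := phi_cheb_centered_rec false k.
rewrite /= IHf IHt IH0 /variance /lin_coef /mean_of in rt rf.
split => //.
- rewrite phi_cheb_rec rt rf IH1 IH0 /variance /lin_coef /mean_of !exprS; ring.
- rewrite rt !exprS; ring.
- rewrite rf !exprS; ring.
Qed.

Let x := p + q - 1.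

Lemma sum_centered : x = centered true + centered false + (al + be - 1) *: 1.
Proof. by rewrite /x/centered; linear_ring. Qed.

Lemma sqr_sum : x * x = w + (U + V) *: 1.
Proof.
rewrite sum_centered (sqr_central centered_sqr) -addrA; congr (_ + _).
rewrite /U /V /lin_coef /variance /mean_of; linear_ring.
Qed.

(** In terms of (p + q - 1)^2 the recursion of the Chebyshev elements becomes a
    rule for raising powers, of the shape required by [cheb_array_ext]. *)
Lemma sqr_cheb k :
  x * x * T k.+1 = T k.+2 + (U + V) *: T k.+1 + (U * V) *: T k.
Proof.
rewrite sqr_sum chebSS mulrDl -scalerAl mul1r /variance /mean_of /U /V; linear_ring.
Qed.

Lemma phi_cheb_x k : phi (T k * x) = U' ^+ k - V' ^+ k.
Proof.
have -> : T k * x = T k * centered true + T k * centered false + (al + be - 1) *: T k.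
  by rewrite sum_centered !mulrDr -scalerAr mulr1.
have [h0 _ ht hf] := phi_cheb k.
rewrite !(linearD, linearZ)/= h0 ht hf /cheb_mean; ring.
Qed.

End FreeMoments.

(** Think of F n k as the value of a functional at c^n T_k. Multiplication by c
    maps T_(k+1) to a combination of its neighbours, so the values at n = 0
    determine all the others. This replaces the expansion of the powers of c in the
    basis of the T_k. *)
Lemma cheb_array_ext (C : comNzRingType) (m D : C) (F G : nat -> nat -> C) :
  (forall n k, F n.+1 k.+1 = F n k.+2 + m * F n k.+1 + D * F n k) ->
  (forall n k, G n.+1 k.+1 = G n k.+2 + m * G n k.+1 + D * G n k) ->
  (forall n, F n 0%N = 0) -> (forall n, G n 0%N = 0) ->
  (forall k, F 0%N k = G 0%N k) -> forall n k, F n k = G n k.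
Proof.
move=> Frec Grec F0 G0 FG; elim=> [//|n IHn] [|k]; first by rewrite F0 G0.
by rewrite Frec Grec !IHn.
Qed.

(** * Freeness in terms of alternating words *)

Section FreeWord.
Local Open Scope complex_scope.
Variables (R : realType) (A : starProbSpace R).

Lemma gen_subalg_shift (x : A) (c : R[i]) : gen_subalg x (x - c *: 1).
Proof.
move=> S [/= [S1 SZ SM] Sx].
have : 1 \in S by exact: S1.
have xS : x \in S by rewrite inE; exact: Sx.
by move=> /(fun h => SZ (- c) _ _ h xS); rewrite inE scaleNr addrC.
Qed.

(** Freeness is used only for the simplest alternating products, those of the
    centered projections themselves. *)
Lemma free_word (p q : A) (al be : R[i]) : free_pair p q ->
  state A p = al -> state A q = be ->
  forall e n, state A (word (centered p q al be) e n.+1) = 0.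
Proof.
move=> pq_free phip phiq e n; rewrite word_prod.
apply: (pq_free n (fun j => centered p q al be (odd j (+) e)) (fun j => odd j (+) e)).
- by move=> j; case: ifP => _; exact: gen_subalg_shift.
- by move=> i j ->; rewrite /= addNb; case: (_ (+) _).
- move=> j; case: (_ (+) _); rewrite /centered linearB linearZ /= (state1 A) mulr1.
    by rewrite phip subrr.
  by rewrite phiq subrr.
Qed.
End FreeWord.

(** * A free pair of projections *)

Section PreHilbert.
Local Open Scope complex_scope.
Variable R : realType.
Local Notation C := R[i].
Local Notation V := {poly C}.
Implicit Types f g h : V.

(** Polynomials serve as the finitely supported sequences, with the monomials
    as an orthonormal basis. *)
Definition ip f g : C := \sum_(i < size f) Num.conj f`_i * g`_i.

Lemma ip_widen N f g : (size f <= N)%N -> ip f g = \sum_(i < N) Num.conj f`_i * g`_i.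
Proof.
move=> fN; rewrite /ip (big_ord_widen _ (fun i => Num.conj f`_i * g`_i) fN).
rewrite big_mkcond /=; apply: eq_bigr => i _; case: ltnP => // fi.
by rewrite nth_default// rmorph0 mul0r.
Qed.

Lemma ipDr f : {morph ip f : g h / g + h}.
Proof.
move=> g h; rewrite /ip -big_split/=; apply: eq_bigr => i _.
by rewrite coefD mulrDr.
Qed.

Lemma ipZr f c g : ip f (c *: g) = c * ip f g.
Proof.
by rewrite /ip mulr_sumr; apply: eq_bigr => i _; rewrite coefZ mulrCA.
Qed.

Lemma ipC f g : ip g f = Num.conj (ip f g).
Proof.
rewrite (@ip_widen (maxn (size f) (size g)) f) ?leq_maxl//.
rewrite (@ip_widen (maxn (size f) (size g)) g) ?leq_maxr//.
rewrite rmorph_sum; apply: eq_bigr => i _.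
by rewrite rmorphM/= conjCK mulrC.
Qed.

Lemma ip_ge0 f : 0 <= ip f f.
Proof. by apply: sumr_ge0 => i _; rewrite mulrC mul_conjC_ge0. Qed.

Lemma ip_Xn n g : ip 'X^n g = g`_n.
Proof.
rewrite (@ip_widen n.+1) ?size_polyXn// big_ord_recr big1 /= ?add0r.
  by rewrite coefXn eqxx rmorph1 mul1r.
by move=> i _; rewrite coefXn ltn_eqF// rmorph0 mul0r.
Qed.

Lemma ip_inj g h : (forall f, ip f g = ip f h) -> g = h.
Proof. by move=> gh; apply/polyP => n; rewrite -!ip_Xn. Qed.

Lemma ip1 g : ip 1 g = g`_0.
Proof. by rewrite -ip_Xn expr0. Qed.

(** An operator is recorded together with its adjoint. Linearity
    follows from the adjunction ([opD], [opZ]). *)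
Record adjop := AdjOp {
  op : V -> V;
  adj : V -> V;
  adjP : forall f g, ip (op f) g = ip f (adj g) }.

HB.instance Definition _ := gen_eqMixin adjop.
HB.instance Definition _ := gen_choiceMixin adjop.
Implicit Types S T : adjop.

Lemma adjP' T f g : ip (adj T f) g = ip f (op T g).
Proof. by rewrite ipC -adjP ipC conjCK. Qed.

(** The inner product is nondegenerate, so an operator determines its adjoint. *)
Lemma adjopP S T : op S =1 op T -> S = T.
Proof.
move=> ST; have STa : adj S = adj T.
  by apply/funext => g; apply: ip_inj => f; rewrite -!adjP ST.
case: S T => [s s' sP] [t t' tP] /= in ST STa *.
move: ST => /funext ST; subst s' t; congr AdjOp.
exact: Prop_irrelevance.
Qed.

Lemma opD T : {morph op T : f g / f + g}.
Proof. by move=> f g; apply: ip_inj => h; rewrite -adjP' ipDr !adjP' ipDr. Qed.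

Lemma opZ T c f : op T (c *: f) = c *: op T f.
Proof. by apply: ip_inj => h; rewrite -adjP' ipZr adjP' ipZr. Qed.

Lemma ipDl f g h : ip (f + g) h = ip f h + ip g h.
Proof. by rewrite ipC ipDr rmorphD /= -!ipC. Qed.

Lemma ipZl c f h : ip (c *: f) h = Num.conj c * ip f h.
Proof. by rewrite ipC ipZr rmorphM /= -!ipC. Qed.

Definition adj_id : adjop := @AdjOp id id (fun f g => erefl).

Program Definition adj_comp S T : adjop :=
  @AdjOp (op S \o op T) (adj T \o adj S) _.
Next Obligation. by move=> S T f g /=; rewrite !adjP. Qed.

Program Definition adj_lin (c : C) S T : adjop :=
  @AdjOp (fun f => c *: op S f + op T f)
    (fun f => Num.conj c *: adj S f + adj T f) _.
Next Obligation.
by move=> c S T f g /=; rewrite ipDl ipDr ipZl ipZr !adjP.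
Qed.

Program Definition adj_zero : adjop := @AdjOp (fun=> 0) (fun=> 0) _.
Next Obligation. by move=> f g /=; rewrite -(scale0r 0) ipZl ipZr rmorph0 !mul0r. Qed.

Definition adj_star T : adjop := @AdjOp (adj T) (op T) (adjP' T).

Let addT S T := adj_lin 1 S T.
Let oppT T := adj_lin (-1) T adj_zero.

Let addTA : associative addT.
Proof. by move=> S T T'; apply: adjopP => f /=; rewrite !scale1r addrA. Qed.
Let addTC : commutative addT.
Proof. by move=> S T; apply: adjopP => f /=; rewrite !scale1r addrC. Qed.
Let add0T : left_id adj_zero addT.
Proof. by move=> S; apply: adjopP => f /=; rewrite scaler0 add0r. Qed.
Let addNT : left_inverse adj_zero oppT addT.
Proof.
by move=> S; apply: adjopP => f /=; rewrite scale1r scaleN1r addr0 addNr.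
Qed.

HB.instance Definition _ := GRing.isZmodule.Build adjop addTA addTC add0T addNT.

Let compA : associative adj_comp.
Proof. by move=> S T T'; apply: adjopP. Qed.
Let comp1T : left_id adj_id adj_comp.
Proof. by move=> S; apply: adjopP. Qed.
Let compT1 : right_id adj_id adj_comp.
Proof. by move=> S; apply: adjopP. Qed.
Let compDl : left_distributive adj_comp +%R.
Proof. by move=> S T T'; apply: adjopP. Qed.
Let compDr : right_distributive adj_comp +%R.
Proof. by move=> S T T'; apply: adjopP => f /=; rewrite !scale1r opD. Qed.
Let id_neq0 : adj_id != 0.
Proof.
apply/eqP => /(congr1 (fun T => op T 1)) /= /eqP.
by rewrite oner_eq0.
Qed.

HB.instance Definition _ := GRing.Zmodule_isNzRing.Build adjop
  compA comp1T compT1 compDl compDr id_neq0.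

Let scaleT c T : adjop := adj_lin c T adj_zero.

Let scaleTE c T f : op (scaleT c T) f = c *: op T f.
Proof. by rewrite /= addr0. Qed.
Let addTE S T f : op (S + T) f = op S f + op T f.
Proof. by rewrite /= scale1r. Qed.

Let scaleTA a b T : scaleT a (scaleT b T) = scaleT (a * b) T.
Proof. by apply: adjopP => f; rewrite !scaleTE scalerA. Qed.
Let scale1T : left_id 1 scaleT.
Proof. by move=> T; apply: adjopP => f; rewrite !scaleTE scale1r. Qed.
Let scaleDr : right_distributive scaleT +%R.
Proof.
by move=> c S T; apply: adjopP => f; rewrite !(addTE, scaleTE) scalerDr.
Qed.
Let scaleDl T : {morph scaleT^~ T : a b / a + b}.
Proof. by move=> a b; apply: adjopP => f; rewrite !(addTE, scaleTE) scalerDl. Qed.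

HB.instance Definition _ := GRing.Zmodule_isLmodule.Build C adjop
  scaleTA scale1T scaleDr scaleDl.

Lemma op_add S T f : op (S + T) f = op S f + op T f. Proof. exact: addTE. Qed.
Lemma op_scale c T f : op (c *: T) f = c *: op T f. Proof. exact: scaleTE. Qed.
Lemma op_mul S T f : op (S * T) f = op S (op T f). Proof. by []. Qed.
Lemma op_one f : op 1 f = f. Proof. by []. Qed.

Let scaleAl c S T : c *: (S * T) = (c *: S) * T.
Proof. by apply: adjopP => f; rewrite !(op_scale, op_mul). Qed.
HB.instance Definition _ := GRing.Lmodule_isLalgebra.Build C adjop scaleAl.

Let scaleAr c S T : c *: (S * T) = S * (c *: T).
Proof. by apply: adjopP => f; rewrite !(op_scale, op_mul) opZ. Qed.
HB.instance Definition _ := GRing.Lalgebra_isAlgebra.Build C adjop scaleAr.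

Definition vacuum (T : adjop) : C := (op T 1)`_0.
Let vacuum_linear : scalar vacuum.
Proof. by move=> c S T; rewrite /vacuum op_add op_scale coefD coefZ. Qed.
HB.instance Definition _ := GRing.isLinear.Build C adjop C *%R vacuum vacuum_linear.

Lemma adj_starD : {morph adj_star : x y / x + y}.
Proof. by move=> S T; apply: adjopP => f /=; rewrite rmorph1. Qed.
Lemma adj_starZ c T : adj_star (c *: T) = Num.conj c *: adj_star T.
Proof. exact: adjopP. Qed.
Lemma adj_starM S T : adj_star (S * T) = adj_star T * adj_star S.
Proof. exact: adjopP. Qed.
Lemma adj_starK : involutive adj_star.
Proof. by move=> T; apply: adjopP. Qed.
Lemma vacuum_ge0 T : 0 <= vacuum (adj_star T * T).
Proof. by rewrite /vacuum op_mul -ip1 /= -adjP ip_ge0. Qed.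
Lemma vacuum1 : vacuum 1 = 1.
Proof. by rewrite /vacuum op_one coef1. Qed.

(** The adjointable operators on the space of finite sequences, with the vector
    state of the first basis vector. *)
Definition fock : starProbSpace R :=
  @StarProbSpace R adjop adj_star vacuum adj_starD adj_starZ adj_starM adj_starK
    vacuum_ge0 vacuum1.

End PreHilbert.

Section BlockProjection.
Local Open Scope complex_scope.
Variable R : realType.
Local Notation C := R[i].
Variables (d : nat -> C) (r : C) (sg : nat -> nat).
Hypotheses (sgK : involutive sg) (sg_le : forall i, (sg i <= i + 3)%N).
Hypotheses (d_real : forall i, Num.conj (d i) = d i) (r_real : Num.conj r = r).
Hypotheses (d_sg : forall i, d i + d (sg i) = 1).
Hypotheses (d_sqr : forall i, d i * d i + r * r = d i).

(** An orthogonal sum of real symmetric two-by-two blocks with diagonal d n,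
    d (sg n) and off-diagonal entry r, one for each pair exchanged by sg. The bound
    on sg keeps the support finite. *)
Definition block (f : {poly C}) : {poly C} :=
  \poly_(i < size f + 3) (d i * f`_i + r * f`_(sg i)).

Lemma coef_block f i : (block f)`_i = d i * f`_i + r * f`_(sg i).
Proof.
rewrite coef_poly; case: ltnP => // fi.
rewrite nth_default ?(leq_trans _ fi) ?leq_addr// mulr0 add0r.
rewrite nth_default ?mulr0//.
by rewrite -(leq_add2r 3) (leq_trans fi)// -{1}(sgK i) sg_le.
Qed.

Lemma block_adj f g : ip (block f) g = ip f (block g).
Proof.
pose N := maxn (size f + 3) (size g).
have fN : (size f <= N)%N by rewrite leq_max leq_addr.
have gN : (size g <= N)%N by rewrite leq_max leqnn orbT.
(* The entry at sg i as a sum over all indices, to which exchange_big applies. *)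
have expand (h : {poly C}) i : (size h <= N)%N ->
    h`_(sg i) = \sum_(j < N) (j == sg i :> nat)%:R * h`_j.
  move=> hN; have [iN|iN] := ltnP (sg i) N.
    rewrite (bigD1 (Ordinal iN)) //= eqxx mul1r big1 ?addr0// => j /negPf.
    by rewrite -val_eqE /= => ->; rewrite mul0r.
  rewrite nth_default ?(leq_trans hN)// big1// => j _.
  by rewrite ltn_eqF ?mul0r// (leq_trans (ltn_ord j)).
rewrite (@ip_widen _ N); last by rewrite (leq_trans (size_poly _ _))// leq_maxl.
rewrite (@ip_widen _ N f)//.
under eq_bigr => i _ do
  rewrite coef_block rmorphD !rmorphM /= d_real r_real mulrDl (expand f i fN)
    rmorph_sum mulr_sumr mulr_suml.
under [RHS]eq_bigr => i _ do
  rewrite coef_block mulrDr (expand g i gN) 2!mulr_sumr.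
rewrite !big_split /=; congr (_ + _).
  by apply: eq_bigr => i _; rewrite mulrCA mulrA.
rewrite exchange_big /=; apply: eq_bigr => i _; apply: eq_bigr => j _.
rewrite rmorphM /= rmorph_nat -(inv_eq sgK) eq_sym; ring.
Qed.

Definition block_op : fock R := AdjOp block_adj.

(** The hypotheses say that each block has trace 1 and determinant 0, and is
    thus a projection of rank one. *)
Lemma block_op_proj : projection block_op.
Proof.
split; first exact: adjopP.
apply: adjopP => f /=; apply/polyP => i; rewrite !coef_block sgK.
have -> : d (sg i) = 1 - d i by rewrite -(d_sg i) addrC addKr.
by rewrite -[X in _ = X * _ + _]d_sqr; ring.
Qed.

Lemma block_Xn n : block 'X^n = d n *: 'X^n + r *: 'X^(sg n).
Proof.
apply/polyP => i; rewrite coef_block coefD !coefZ !coefXn (inv_eq sgK).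
by case: (i =P n) => [->//|_]; rewrite !mulr0.
Qed.

End BlockProjection.

Section FreeModel.
Local Open Scope complex_scope.
Variable R : realType.
Local Notation C := R[i].
Variables (al be : R).
Hypotheses (al01 : 0 <= al <= 1) (be01 : 0 <= be <= 1).

(** The basis vectors stand for the alternating words: the exponent 0 for the
    empty word, 2n - 1 and 2n for the words of length n that begin with p and with
    q. A letter acts on the pairs formed by a word w not beginning with it and the
    word obtained by putting it in front of w; flip_p and flip_q exchange
    the members of these pairs. *)
Definition flip_p (n : nat) : nat := if odd n then n.-1 else n.+1.
Definition flip_q (n : nat) : nat :=
  (if odd n then n + 3 else if n <= 2 then 2 - n else n - 3)%N.
(** On the pair (w, pw) the projection p is the matrix with the rows
    (al, off al) and (off al, 1 - al), which is p in the orthonormal basis of the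
    span of 1 and p in the law of p. *)
Definition diag_p (n : nat) : C := if odd n then (1 - al)%:C else al%:C.
Definition diag_q (n : nat) : C :=
  if odd n || (n == 0)%N then be%:C else (1 - be)%:C.
Definition off (c : R) : C := (Num.sqrt (c * (1 - c)))%:C.

Lemma flip_pK : involutive flip_p.
Proof.
move=> n; rewrite /flip_p; case: (boolP (odd n)) => [|no]; last first.
  by rewrite /= no.
by case: n => //= n /negPf ->.
Qed.

Lemma flip_p_le n : (flip_p n <= n + 3)%N.
Proof.
rewrite /flip_p; case: ifP => _; last by rewrite addn3 !ltnS -addn2 leq_addr.
by rewrite (leq_trans (leq_pred _))// leq_addr.
Qed.

Lemma flip_qK : involutive flip_q.
Proof.
case=> [|[|[|n]]] //; rewrite /flip_q /= negbK !subSS subn0.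
case: (boolP (odd n)) => [no|ne]; first by rewrite no addn3.
by rewrite addn3 /= negbK (negPf ne) !subSS subn0.
Qed.

Lemma flip_q_le n : (flip_q n <= n + 3)%N.
Proof.
rewrite /flip_q; case: ifP => // _; case: ifP => _.
  by rewrite (leq_trans (leq_subr _ _))// addn3.
by rewrite (leq_trans (leq_subr _ _))// leq_addr.
Qed.

Lemma conj_real (c : R) : Num.conj c%:C = c%:C.
Proof. by apply/eqP; rewrite eq_complex /= oppr0 !eqxx. Qed.

Lemma diag_off (c : R) : 0 <= c <= 1 -> forall b : bool,
  let x := (if b then (1 - c)%:C else c%:C) in x * x + off c * off c = x.
Proof.
move=> /andP[c0 c1] b /=.
have c2 : Num.sqrt (c * (1 - c)) * Num.sqrt (c * (1 - c)) = c * (1 - c).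
  by rewrite -expr2 sqr_sqrtr// mulr_ge0// subr_ge0.
rewrite /off -!rmorphM c2; case: b; rewrite -!rmorphM -rmorphD; congr (_%:C); ring.
Qed.

Lemma diag_p_flip n : diag_p n + diag_p (flip_p n) = 1.
Proof.
rewrite /diag_p /flip_p; case: ifP => [|no]; last first.
  by rewrite /= no /= -rmorphD addrC subrK.
by case: n => //= n /negPf ->; rewrite -rmorphD subrK.
Qed.

Lemma diag_q_flip n : diag_q n + diag_q (flip_q n) = 1.
Proof.
have E1 : be%:C + (1 - be)%:C = 1 :> C by rewrite -rmorphD addrC subrK.
case: n => [|[|[|n]]] //=; rewrite /diag_q /flip_q /= ?orbF ?negbK //.
  by rewrite addrC.
rewrite !subSS subn0; case: (boolP (odd n)) => [no|ne] /=.
  by rewrite no /= addrC.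
by rewrite addn3 /= !negbK (negPf ne).
Qed.

Lemma diag_p_real n : Num.conj (diag_p n) = diag_p n.
Proof. by rewrite /diag_p; case: ifP => _; exact: conj_real. Qed.

Lemma diag_q_real n : Num.conj (diag_q n) = diag_q n.
Proof. by rewrite /diag_q; case: ifP => _; exact: conj_real. Qed.

Lemma off_real c : Num.conj (off c) = off c.
Proof. exact: conj_real. Qed.

Definition fock_p : fock R :=
  block_op flip_pK flip_p_le diag_p_real (off_real al).
Definition fock_q : fock R :=
  block_op flip_qK flip_q_le diag_q_real (off_real be).

Lemma fock_p_proj : projection fock_p.
Proof.
apply: block_op_proj; first exact: diag_p_flip.
move=> n; have := diag_off al01 (odd n); rewrite /= /diag_p.
by case: (odd n).
Qed.

Lemma fock_q_proj : projection fock_q.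
Proof.
apply: block_op_proj; first exact: diag_q_flip.
move=> n; have := diag_off be01 (~~ (odd n || (n == 0)%N)); rewrite /= /diag_q.
by case: (_ || _).
Qed.

Lemma fock_p_Xn n :
  op fock_p 'X^n = diag_p n *: 'X^n + off al *: 'X^(flip_p n).
Proof. exact: (block_Xn _ _ flip_pK flip_p_le). Qed.

Lemma fock_q_Xn n :
  op fock_q 'X^n = diag_q n *: 'X^n + off be *: 'X^(flip_q n).
Proof. exact: (block_Xn _ _ flip_qK flip_q_le). Qed.

Definition word_pos (e : bool) (n : nat) : nat := if e then n.*2.-1 else n.*2.

(** The centered letter maps a word not beginning with it to a multiple of the
    longer word: the diagonal coefficient at the shorter word of the pair is
    the mean, and centering removes it. *)
Lemma fock_word e n : exists c,
  op (word (centered fock_p fock_q al%:C be%:C) e n) 1 = c *: 'X^(word_pos e n).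
Proof.
elim: n e => [|n IHn] e.
  by exists 1; rewrite scale1r op_one /word_pos; case: e.
have [c Ec] := IHn (~~ e).
rewrite wordS op_mul Ec opZ; exists (c * (if e then off al else off be)).
rewrite -scalerA; congr (_ *: _); case: e {IHn Ec}; rewrite /centered /word_pos.
  rewrite op_add -scaleNr op_scale op_one.
  rewrite fock_p_Xn /diag_p /flip_p odd_double.
  by rewrite addrAC scaleNr subrr add0r.
rewrite op_add -scaleNr op_scale op_one.
rewrite fock_q_Xn /diag_q /flip_q.
case: n => [|n] /=; first by rewrite addrAC scaleNr subrr add0r.
by rewrite odd_double /= addrAC scaleNr subrr add0r addn3.
Qed.

Lemma fock_word0 e n :
  state (fock R) (word (centered fock_p fock_q al%:C be%:C) e n.+1) = 0.
Proof.
rewrite /= /vacuum; have [c ->] := fock_word e n.+1.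
by rewrite coefZ coefXn; case: e; rewrite /= mulr0.
Qed.

Lemma fock_p_mean : state (fock R) fock_p = al%:C.
Proof.
have := fock_word0 true 0; rewrite /= mulr1 linearB linearZ /= vacuum1 mulr1.
by move/eqP; rewrite subr_eq0 => /eqP.
Qed.

Lemma fock_q_mean : state (fock R) fock_q = be%:C.
Proof.
have := fock_word0 false 0; rewrite /= mulr1 linearB linearZ /= vacuum1 mulr1.
by move/eqP; rewrite subr_eq0 => /eqP.
Qed.

End FreeModel.

Section FreeFock.
Local Open Scope complex_scope.

(** For an idempotent x the span of 1 and x is closed under products. *)
Lemma gen_subalg_idem (R : realType) (A : starProbSpace R) (x y : A) :
  x * x = x -> gen_subalg x y -> exists c d, y = c *: 1 + d *: x.
Proof.
move=> xx /(_ [set z | exists c d, z = c *: 1 + d *: x]); apply; split; last first.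
  by move=> _ ->; exists 0, 1; rewrite scale0r add0r scale1r.
split.
- by rewrite inE; exists 1, 0; rewrite scale0r addr0 scale1r.
- move=> a u v; rewrite !inE => -[c [d ->]] [c' [d' ->]].
  exists (a * c + c'), (a * d + d').
  by rewrite !scalerDl !scalerDr !scalerA addrACA.
- move=> u v; rewrite !inE => -[c [d ->]] [c' [d' ->]].
  exists (c * c'), (c * d' + d * c' + d * d').
  rewrite !(mulrDl, mulrDr) -!(scalerAl, scalerAr) !(mul1r, mulr1) xx.
  by linear_ring.
Qed.

(** A centered element of the algebra generated by a projection is a multiple of
    the centered projection, and the sides alternate. So every product occurring in
    the definition of freeness is a multiple of a word. *)
Lemma free_of_word (R : realType) (A : starProbSpace R) (p q : A) (al be : R[i]) :
  p * p = p -> q * q = q -> state A p = al -> state A q = be ->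
  (forall e n, state A (word (centered p q al be) e n.+1) = 0) -> free_pair p q.
Proof.
move=> pp qq phip phiq w0 m a side a_in side_alt a0.
have sideE (j : 'I_m.+1) : side j = odd j (+) side ord0.
  case: j => j; elim: j => [|j IHj] jm; first by congr side; apply: val_inj.
  have := side_alt (Ordinal (ltnW jm)) (Ordinal jm) erefl.
  rewrite IHj /= addNb; case: (side (Ordinal jm)); by case: (_ (+) _).
have aE (j : 'I_m.+1) : exists d, a j = d *: centered p q al be (odd j (+) side ord0).
  have := a_in j; have := a0 j; rewrite -sideE /centered; case: (side j) => aj.
    move=> /(gen_subalg_idem pp)[c [d E]]; exists d; move: aj.
    rewrite E linearD !linearZ /= (state1 A) phip mulr1 => /eqP.
    rewrite addr_eq0 => /eqP ->; linear_ring.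
  move=> /(gen_subalg_idem qq)[c [d E]]; exists d; move: aj.
  rewrite E linearD !linearZ /= (state1 A) phiq mulr1 => /eqP.
  rewrite addr_eq0 => /eqP ->; linear_ring.
have [d dE] := choice aE.
rewrite (eq_bigr _ (fun j _ => dE j)) scaler_prod linearZ /=.
by rewrite -(word_prod (centered p q al be)) w0 mulr0.
Qed.

Lemma fock_free (R : realType) (al be : R) (al01 : 0 <= al <= 1)
  (be01 : 0 <= be <= 1) : free_pair (fock_p al) (fock_q be).
Proof.
apply: (@free_of_word _ _ _ _ al%:C be%:C).
- by have [] := fock_p_proj al01.
- by have [] := fock_q_proj be01.
- exact: fock_p_mean be.
- exact: fock_q_mean al be.
- exact: fock_word0.
Qed.

End FreeFock.

(** * Change of variables on open intervals *)

Section Substitution.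
Variable R : realType.
Notation mu := (@lebesgue_measure R).

(** Neither G nor F' need be bounded near the endpoints: the formula on compact
    intervals is exhausted by monotone convergence. The density treated
    below may be unbounded near 0 and 2, namely when alpha + beta = 1. *)
Lemma ge0_substitution_decreasing_oo (F F' G : R -> R) (a b c d : R) : a < b ->
  (forall x : R, x \in `]a, b[ -> is_derive x 1 F (F' x)) ->
  {in `]a, b[, forall x, F' x < 0} ->
  {in `]a, b[, continuous F'} ->
  {in `]c, d[, continuous G} -> {in `]c, d[, forall y, 0 <= G y} ->
  {in `]a, b[, forall x, F x \in `]c, d[} ->
  (forall y, y \in `]c, d[ -> exists2 x, x \in `]a, b[ & F x = y) ->
  (\int[mu]_(y in `]c, d[) (G y)%:E =
   \int[mu]_(x in `]a, b[) (G (F x) * - F' x)%:E)%E.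
Proof.
move=> ab dF F'0 cF' cG G0 Fcd Fsurj.
have F'E x : x \in `]a, b[ -> derive1 F x = F' x.
  by move=> xab; rewrite derive1E; have := dF _ xab => /@derive_val.
have cF x : x \in `]a, b[ -> {for x, continuous F}.
  move=> xab; apply: differentiable_continuous; apply/derivable1_diffP.
  exact: (@ex_derive _ _ _ _ _ _ _ (dF _ xab)).
have decF : {in `]a, b[ &, {homo F : x y /~ x < y}}.
  apply: ltr0_derive1_lt_oo.
  - by move=> x xab; exact: (@ex_derive _ _ _ _ _ _ _ (dF _ xab)).
  - by move=> x xab; rewrite F'E// F'0.
  - by move=> x; rewrite inE; exact: cF.
(* The intervals [a + dl n, b - dl n] increase to ]a, b[; for n = 0 this is a point. *)
pose dl n : R := (b - a) / 2 / n.+1%:R.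
have dl_gt0 n : 0 < dl n by rewrite !divr_gt0// subr_gt0.
have dl_le n : dl n <= (b - a) / 2.
  by rewrite /dl ler_pdivrMr// ler_peMr// ?ler1n// ltW// divr_gt0// subr_gt0.
have dl_nincr n m : (n <= m)%N -> dl m <= dl n.
  move=> nm; rewrite /dl ler_pM2l ?divr_gt0 ?subr_gt0//.
  by rewrite lef_pV2 ?posrE// ler_nat.
have dl_small e : 0 < e -> exists n, dl n <= e.
  move=> e0; have ba2 : 0 < (b - a) / 2 by rewrite divr_gt0// subr_gt0.
  have [k] := ltr_add_invr (divr_gt0 e0 ba2); rewrite add0r => /ltW ke.
  by exists k; rewrite /dl mulrC -ler_pdivlMr.
pose E n := `[a + dl n, b - dl n]%classic.
pose E' n := `[F (b - dl n), F (a + dl n)]%classic.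
have an_in n : a + dl n \in `]a, b[.
  by rewrite in_itv/=; have := dl_gt0 n; have := dl_le n => *; apply/andP; split; lra.
have bn_in n : b - dl n \in `]a, b[.
  by rewrite in_itv/=; have := dl_gt0 n; have := dl_le n => *; apply/andP; split; lra.
have Eab n x : x \in `[a + dl n, b - dl n] -> x \in `]a, b[.
  by rewrite !in_itv/= => /andP[? ?]; have := dl_gt0 n => *; apply/andP; split; lra.
have leF : {in `]a, b[ &, {homo F : x y /~ x <= y}}.
  by move=> x y xab yab; rewrite le_eqVlt => /predU1P[->//|/decF]; move=> /(_ xab yab)/ltW.
have E'cd n y : y \in `[F (b - dl n), F (a + dl n)] -> y \in `]c, d[.
  have := Fcd _ (an_in n); have := Fcd _ (bn_in n); rewrite !in_itv/=.
  move=> /andP[h1 h2] /andP[h3 h4] /andP[h5 h6].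
  by rewrite (lt_le_trans h1 h5) (le_lt_trans h6 h4).
have cGF x : x \in `]a, b[ -> {for x, continuous (fun x => G (F x) * - F' x)}.
  move=> xab; apply: continuousM; last by apply: continuousN; exact: cF'.
  by apply: continuous_comp; [exact: cF|apply: cG; exact: Fcd].
have UE : \bigcup_n E n = `]a, b[%classic.
  apply/seteqP; split => [x [n _]|x /=]; first by move/Eab.
  rewrite in_itv/= => /andP[ax xb].
  have [|n] := dl_small (Num.min (x - a) (b - x)); first by rewrite lt_min !subr_gt0 ax.
  by rewrite le_min => /andP[? ?]; exists n => //; rewrite /E/= in_itv/=; apply/andP; split; lra.
have UE' : \bigcup_n E' n = `]c, d[%classic.
  apply/seteqP; split => [x [n _]|y /= ycd]; first by move/E'cd.
  have [x xab <-] := Fsurj _ ycd.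
  have : x \in `]a, b[%classic by rewrite inE.
  rewrite -UE inE => -[n _ En]; exists n => //=; move: (En); rewrite /E /= !in_itv/=.
  by move=> /andP[h1 h2]; apply/andP; split; apply: leF.
have EE' n : (\int[mu]_(y in E' n) (G y)%:E = \int[mu]_(x in E n) (G (F x) * - F' x)%:E)%E.
  have ablen : a + dl n <= b - dl n by have := dl_le n; lra.
  have near_ab x : x \in `]a, b[ -> \forall y \near x, F' y = derive1 F y.
    by move=> xab; near=> y; rewrite F'E//; near: y; exact: near_in_itvoo.
  have cdF x : x \in `]a, b[ -> {for x, continuous (derive1 F)}.
    move=> xab; rewrite /prop_for /continuous_at F'E//.
    apply: cvg_trans (cF' _ xab); apply: near_eq_cvg; exact: near_ab.
  rewrite (@integration_by_substitution_decreasing _ F G) //.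
  - apply: eq_integral => x /[!inE] xE; rewrite !fctE F'E//; exact: Eab xE.
  - by move=> x y /Eab xE /Eab yE; exact: decF.
  - by move=> x xE; apply: cdF; apply: (Eab n); exact: subset_itv_oo_cc xE.
  - by apply/cvg_ex; exists (derive1 F (a + dl n)); apply: cvg_at_right_filter; exact: cdF.
  - by apply/cvg_ex; exists (derive1 F (b - dl n)); apply: cvg_at_left_filter; exact: cdF.
  - split.
    + move=> x xE; apply: (@ex_derive _ _ _ _ _ _ _ (dF _ _)).
      by apply: (Eab n); exact: subset_itv_oo_cc xE.
    + by apply: cvg_at_right_filter; exact: cF.
    + by apply: cvg_at_left_filter; exact: cF.
  - apply: continuous_in_subspaceT => y; rewrite inE/= => yE.
    by apply: cG; exact: E'cd yE.
have cvgl : (\int[mu]_(y in E' n) (G y)%:E @[n --> \oo] -->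
    \int[mu]_(y in `]c, d[) (G y)%:E)%E.
  rewrite -UE'.
  apply: (@ge0_nondecreasing_set_cvg_integral _ (measurableTypeR R) R E'
    (EFin \o G) mu).
  - move=> n m nm; rewrite subsetEset /E' => y /=; rewrite !in_itv/= => /andP[h1 h2].
    have := dl_nincr _ _ nm => h.
    by apply/andP; split; [apply: le_trans h1|apply: le_trans h2 _]; apply: leF => //; lra.
  - by move=> n; exact: measurable_itv.
  - move=> n; apply/measurable_EFinP.
    apply: subspace_continuous_measurable_fun; first exact: measurable_itv.
    apply: continuous_in_subspaceT => y; rewrite inE/= => yE.
    by apply: cG; exact: E'cd yE.
  - by move=> n y yE; rewrite lee_fin G0//; exact: E'cd yE.
have cvgr : (\int[mu]_(x in E n) (G (F x) * - F' x)%:E @[n --> \oo] -->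
    \int[mu]_(x in `]a, b[) (G (F x) * - F' x)%:E)%E.
rewrite -UE.
apply: (@ge0_nondecreasing_set_cvg_integral _ (measurableTypeR R) R E
  (fun x => (G (F x) * - F' x)%:E) mu).
- move=> n m nm; rewrite subsetEset /E => y /=; rewrite !in_itv/= => /andP[h1 h2].
  by have := dl_nincr _ _ nm => h; apply/andP; split; lra.
- by move=> n; exact: measurable_itv.
- move=> n; apply/measurable_EFinP.
  apply: subspace_continuous_measurable_fun; first exact: measurable_itv.
  apply: continuous_in_subspaceT => y; rewrite inE/= => yE.
  by apply: cGF; exact: Eab yE.
- move=> n y /Eab yE; rewrite lee_fin mulr_ge0//; first by apply: G0; exact: Fcd.
  by rewrite oppr_ge0 ltW// F'0.
move: cvgl; under eq_fun do rewrite EE'.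
by move=> /cvg_unique; apply.
Unshelve. all: end_near. Qed.

End Substitution.

(** * Poisson kernels and Chebyshev polynomials *)

Section Kernel.
Variable R : realType.
Notation mu := (@lebesgue_measure R).

Lemma Rintegral_FTC_oo (f F : R -> R) (a b : R) : a < b ->
  (forall x : R, is_derive x 1 F (f x)) -> continuous f ->
  \int[mu]_(x in `]a, b[) f x = F b - F a.
Proof.
move=> ab dF cf.
have cF x : {for x, continuous F}.
  apply: differentiable_continuous; apply/derivable1_diffP.
  exact: (@ex_derive _ _ _ _ _ _ _ (dF x)).
rewrite /Rintegral -(@integral_itv_bndoo _ a b (EFin \o f) true false); last first.
  apply/measurable_EFinP; apply: measurable_funTS.
  exact: continuous_measurable_fun.
rewrite (@continuous_FTC2 _ f F)//.
- by apply: continuous_subspaceT => x; exact: cf.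
- split.
  + by move=> x _; exact: (@ex_derive _ _ _ _ _ _ _ (dF x)).
  + by apply: cvg_at_right_filter; exact: cF.
  + by apply: cvg_at_left_filter; exact: cF.
- by move=> x _; rewrite derive1E; have := dF x => /@derive_val.
Qed.

Lemma integrable_0pi (f : R -> R) (M : R) : measurable_fun `]0, pi[ f ->
  (forall x, 0 < x < pi -> `|f x| <= M) -> mu.-integrable `]0, pi[ (EFin \o f).
Proof.
move=> mf fM; apply: measurable_bounded_integrable => //.
  by rewrite /= lebesgue_measure_itv/= lte_fin pi_gt0 -EFinD ltry.
exists M; split; first exact: num_real.
move=> M' /ltW MM' x /=; rewrite in_itv/= => xpi.
exact: le_trans (fM x xpi) MM'.
Qed.

Lemma integrable_scale (D : set R) k (f : R -> R) : measurable D ->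
  mu.-integrable D (EFin \o f) -> mu.-integrable D (EFin \o (fun x => k * f x)).
Proof.
move=> mD fi; rewrite (_ : EFin \o _ = (fun x => k%:E * (EFin \o f) x)%E).
  exact: integrableZl.
by apply/funext => x /=; rewrite EFinM.
Qed.

Lemma integrable_add (D : set R) (f1 f2 : R -> R) : measurable D ->
  mu.-integrable D (EFin \o f1) -> mu.-integrable D (EFin \o f2) ->
  mu.-integrable D (EFin \o (fun x => f1 x + f2 x)).
Proof.
move=> mD h1 h2; rewrite (_ : EFin \o _ = ((EFin \o f1) \+ (EFin \o f2))%E) //.
exact: integrableD.
Qed.

Lemma normr_cos_le1 (k x : R) : `|k * cos x| <= `|k|.
Proof. by rewrite normrM ler_piMr// ler_norml cos_geN1 cos_le1. Qed.

Lemma sin_natpi n : sin (n%:R * pi : R) = 0.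
Proof.
elim: n => [|n IH]; first by rewrite mul0r sin0.
by rewrite -natr1 mulrDl mul1r sinDpi IH oppr0.
Qed.

Lemma Rintegral_sin2 : \int[mu]_(x in `]0, pi[) (sin x ^+ 2) = pi / 2.
Proof.
pose F (x : R) : R := x / 2 - sin x * cos x / 2.
have dF (x : R) : is_derive x 1 F (sin x ^+ 2).
  apply: is_derive_eq; rewrite !scaler0 !add0r /GRing.scale /=.
  have := cos2Dsin2 x; lra.
rewrite (Rintegral_FTC_oo (pi_gt0 R) dF).
  by rewrite /F sinpi sin0 !mul0r !subr0.
by move=> x; apply: cvgM; exact: continuous_sin.
Qed.

Lemma Rintegral_sin_orthogonal k :
  \int[mu]_(x in `]0, pi[) (sin x * sin (k.+2%:R * x)) = 0.
Proof.
pose F (x : R) : R := (sin (k.+1%:R * x) / k.+1%:R - sin (k.+3%:R * x) / k.+3%:R) / 2.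
have dF (x : R) : is_derive x 1 F (sin x * sin (k.+2%:R * x)).
  apply: is_derive_eq.
  rewrite !scaler0 !add0r /GRing.scale /= !mulr1.
  have -> : k.+3%:R * x = k.+2%:R * x + x by rewrite -[k.+3]addn1 natrD mulrDl mul1r.
  have -> : k.+1%:R * x = k.+2%:R * x - x by rewrite -[k.+2]addn1 natrD mulrDl mul1r addrK.
  rewrite cosB cosD; field.
  by apply/andP; split; rewrite gt_eqF//; have := ler0n R k; lra.
rewrite (Rintegral_FTC_oo (pi_gt0 R) dF).
  by rewrite /F !sin_natpi !mulr0 sin0 !(mul0r, subr0).
move=> x; apply: cvgM; first exact: continuous_sin.
apply: continuous_comp; last exact: continuous_sin.
by apply: cvgM; [exact: cvg_cst|].
Qed.

(** The real counterpart of [cheb], with y for the central element. *)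
Fixpoint chebr (D y : R) (k : nat) : R :=
  match k with
  | 0 => 0
  | 1 => 1
  | (k'.+1 as m).+1 => y * chebr D y m - D * chebr D y k'
  end.

Lemma chebrSS D y k : chebr D y k.+2 = y * chebr D y k.+1 - D * chebr D y k.
Proof. by []. Qed.

Lemma chebr_sin r x k :
  r * (sin x * chebr (r ^+ 2) (2 * r * cos x) k) = r ^+ k * sin (k%:R * x).
Proof.
elim/nat_ind2: k => [||k IH0 IH1].
- by rewrite mul0r sin0 /= !mulr0.
- by rewrite mul1r /= mulr1 expr1.
have E : sin (k.+2%:R * x) = 2 * cos x * sin (k.+1%:R * x) - sin (k%:R * x).
  have -> : k.+2%:R * x = k.+1%:R * x + x by rewrite -[k.+2]addn1 natrD mulrDl mul1r.
  have -> : k%:R * x = k.+1%:R * x - x by rewrite -[k.+1]addn1 natrD mulrDl mul1r addrK.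
  by rewrite sinB sinD; ring.
rewrite chebrSS E.
transitivity (2 * r * cos x * (r * (sin x * chebr (r ^+ 2) (2 * r * cos x) k.+1))
  - r ^+ 2 * (r * (sin x * chebr (r ^+ 2) (2 * r * cos x) k))); first ring.
by rewrite IH0 IH1 !exprS; ring.
Qed.

Lemma continuous_chebr D (f : R -> R) k : continuous f ->
  continuous (fun x => chebr D (f x) k).
Proof.
move=> cf; elim/nat_ind2: k => [||k IH0 IH1] x.
- exact: cvg_cst.
- exact: cvg_cst.
- rewrite [X in continuous_at x X](_ : _ =
    (fun x => f x * chebr D (f x) k.+1 - D * chebr D (f x) k))//.
  apply: cvgB; first by apply: cvgM; [exact: cf|exact: IH1].
  by apply: cvgM; [exact: cvg_cst|exact: IH0].
Qed.

Lemma chebr_bounded D Y k :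
  exists M, forall y, `|y| <= Y -> `|chebr D y k| <= M.
Proof.
elim/nat_ind2: k => [||k [M0 h0] [M1 h1]].
- by exists 0 => y _; rewrite normr0.
- by exists 1 => y _; rewrite normr1.
- exists (Y * M1 + `|D| * M0) => y yY; rewrite chebrSS.
  apply: le_trans (ler_normB _ _) _; rewrite !normrM.
  by apply: lerD; apply: ler_pM => //; [exact: h1|exact: h0].
Qed.

(** Orthogonality of the Chebyshev polynomials of positive degree to the
    constant 1 for the semicircle weight. *)
Lemma Rintegral_sin2_chebr r k : r != 0 ->
  \int[mu]_(x in `]0, pi[) (sin x ^+ 2 * chebr (r ^+ 2) (2 * r * cos x) k.+1) =
  if k is 0 then pi / 2 else 0.
Proof.
move=> r0; case: k => [|k].
  by rewrite -Rintegral_sin2; apply: eq_Rintegral => x _ /=; rewrite mulr1.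
have E x : sin x ^+ 2 * chebr (r ^+ 2) (2 * r * cos x) k.+2 =
    r ^+ k.+1 * (sin x * sin (k.+2%:R * x)).
  apply: (mulfI r0).
  transitivity (sin x * (r * (sin x * chebr (r ^+ 2) (2 * r * cos x) k.+2))).
    ring.
  rewrite chebr_sin exprS; ring.
under eq_Rintegral do rewrite E.
rewrite RintegralZl ?Rintegral_sin_orthogonal ?mulr0//.
apply: (integrable_0pi (M := 1)).
- apply: measurable_funTS; apply: continuous_measurable_fun => x.
  apply: cvgM; first exact: continuous_sin.
  apply: continuous_comp; last exact: continuous_sin.
  by apply: cvgM; [exact: cvg_cst|].
- move=> x _; rewrite normrM.
  by rewrite -[leRHS]mulr1 ler_pM//; rewrite ler_norml sin_geN1 sin_le1.
Qed.

Section PoissonKernel.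
Variables (n N r : R).
Hypotheses (n_gt0 : 0 < n) (le_nN : n <= N) (rE : r ^+ 2 = n * N).

Let N_gt0 : 0 < N. Proof. exact: lt_le_trans n_gt0 le_nN. Qed.
Let r_neq0 : r != 0.
Proof. by rewrite -sqrf_eq0 rE mulf_neq0// gt_eqF. Qed.

(** With r^2 = n N this is | sqrt N - sqrt n e^(ix) |^2 up to the sign of r, the
    denominator of a Poisson kernel. It vanishes at an endpoint of [0, pi] exactly
    when n = N. *)
Definition poisson_den (x : R) : R := n + N - 2 * r * cos x.

(* The factor sin^2 x compensates the zero of the denominator in the case n = N. *)
Let den_ge (x : R) : `|r| * sin x ^+ 2 <= poisson_den x.
Proof.
rewrite sin2cos2 /poisson_den.
have := cos_le1 x; have := cos_geN1 x; set c := cos x => c1 c2.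
have r2 : 2 * `|r| <= n + N.
  rewrite -(@ler_pXn2r _ 2) ?nnegrE ?mulr_ge0 ?addr_ge0 ?(ltW n_gt0) ?(ltW N_gt0)//.
  rewrite exprMn real_normK ?num_real// rE; have := sqr_ge0 (n - N); lra.
have : 2 * r * c <= `|r| * (1 + c ^+ 2).
  have : 0 <= `|r| * (1 - c) ^+ 2 by rewrite mulr_ge0 ?sqr_ge0.
  have : 0 <= `|r| * (1 + c) ^+ 2 by rewrite mulr_ge0 ?sqr_ge0.
  by have [r0|r0] := leP 0 r; [rewrite ger0_norm|rewrite ltr0_norm]; lra.
lra.
Qed.

Lemma poisson_den_gt0 (x : R) : 0 < x < pi -> 0 < poisson_den x.
Proof.
move=> xpi; apply: lt_le_trans (den_ge x).
by rewrite mulr_gt0 ?normr_gt0// exprn_gt0// sin_gt0_pi.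
Qed.

Lemma continuous_poisson_den : continuous poisson_den.
Proof.
move=> x; apply: cvgB; first exact: cvg_cst.
by apply: cvgM; [exact: cvg_cst|exact: continuous_cos].
Qed.

Lemma integrable_poisson (h : R -> R) (M : R) : continuous h ->
  (forall x, `|h x| <= M) ->
  mu.-integrable `]0, pi[ (EFin \o (fun x => sin x ^+ 2 * h x / poisson_den x)).
Proof.
move=> ch hM; apply: (integrable_0pi (M := M / `|r|)).
- apply: subspace_continuous_measurable_fun => //.
  apply: continuous_in_subspaceT => x; rewrite inE/= in_itv/= => xpi.
  apply: cvgM.
    apply: cvgM; last exact: ch.
    by apply: cvgM; exact: continuous_sin.
  apply: continuousV; last exact: continuous_poisson_den.
  by rewrite gt_eqF// poisson_den_gt0.
- move=> x xpi; have M0 : 0 <= M by exact: le_trans (hM 0).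
  have d0 := poisson_den_gt0 xpi.
  rewrite normf_div normrM (gtr0_norm d0) ler_pdivrMr//.
  rewrite ger0_norm ?sqr_ge0// [leRHS]mulrAC ler_pdivlMr ?normr_gt0//.
  rewrite mulrAC [leRHS]mulrC; apply: ler_pM => //; first by rewrite mulr_ge0 ?sqr_ge0.
  by rewrite mulrC.
Qed.

(** If n < N, the quotient has a primitive, smooth on the whole line, which
    contains the argument of N - r e^(-ix) and so increases by the same amount as
    its linear term alone. If n = N, then the quotient is a linear function of
    cos x. *)
Lemma Rintegral_poisson1 :
  \int[mu]_(x in `]0, pi[) (sin x ^+ 2 / poisson_den x) = pi / (2 * N).
Proof.
move: le_nN; rewrite le_eqVlt => /predU1P[nN|nN].
  have r2 : r ^+ 2 = N ^+ 2 by rewrite rE nN.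
  (* Here (r / N)^2 = 1, so sin^2 x = (1 - (r / N) cos x)(1 + (r / N) cos x). *)
  pose F (x : R) : R := x / (2 * N) + sin x * (r / N) / (2 * N).
  have dF (x : R) : is_derive x 1 F ((1 + cos x * (r / N)) / (2 * N)).
    apply: is_derive_eq; rewrite !scaler0 !add0r /GRing.scale /=.
    by field; rewrite gt_eqF.
  rewrite -[RHS](_ : F pi - F 0 = _); last first.
    by rewrite /F sinpi sin0 !mul0r !addr0 subr0.
  rewrite -(Rintegral_FTC_oo (pi_gt0 R) dF).
    apply: eq_Rintegral => x; rewrite inE/= in_itv/= => xpi.
    have d0 := poisson_den_gt0 xpi.
    have N20 : 2 * N != 0 by rewrite gt_eqF// mulr_gt0.
    apply/eqP; rewrite eqr_div ?(gt_eqF d0)//.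
    have -> : poisson_den x = 2 * N - 2 * r * cos x by rewrite /poisson_den nN; ring.
    rewrite sin2cos2; apply/eqP.
    transitivity (2 * N - 2 * cos x ^+ 2 * (r ^+ 2 / N)); last by field; rewrite gt_eqF.
    by rewrite r2; field; rewrite gt_eqF.
  move=> x; apply: cvgM; last exact: cvg_cst.
  apply: cvgD; first exact: cvg_cst.
  by apply: cvgM; [exact: continuous_cos|exact: cvg_cst].
have r_lt : `|r| < N.
  rewrite -(@ltr_pXn2r _ 2) ?nnegrE ?(ltW N_gt0)// real_normK ?num_real// rE expr2.
  by rewrite ltr_pM2r.
have cr_lt (x : R) : r * cos x < N.
  apply: le_lt_trans (ler_norm _) _; rewrite normrM; apply: le_lt_trans r_lt.
  by rewrite ler_piMr// ler_norml cos_geN1 cos_le1.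
have den0 (x : R) : 0 < poisson_den x.
  rewrite /poisson_den.
  have : 2 * `|r| < n + N.
    rewrite -(@ltr_pXn2r _ 2) ?nnegrE ?mulr_ge0 ?addr_ge0 ?(ltW n_gt0) ?(ltW N_gt0)//.
    rewrite exprMn real_normK ?num_real// rE.
    have : 0 < (N - n) ^+ 2 by rewrite exprn_gt0// subr_gt0.
    lra.
  have : r * cos x <= `|r|.
    apply: le_trans (ler_norm _) _; rewrite normrM.
    by rewrite ler_piMr// ler_norml cos_geN1 cos_le1.
  lra.
(* The atan term is the argument of N - r e^(-ix), smooth because r cos x < N. *)
pose F (x : R) : R := x / (2 * N) + sin x / (2 * r)
  - (N - n) / (2 * n * N) * atan (r * sin x * (N - r * cos x)^-1).
have dF (x : R) : is_derive x 1 F (sin x ^+ 2 / poisson_den x).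
  have q0 : N - r * cos x != 0 by rewrite gt_eqF// subr_gt0.
  have dq : is_derive x 1 (fun y : R => (N - r * cos y)^-1)
      (- (N - r * cos x) ^- 2 *: (r * sin x)).
    apply: is_deriveV => //; apply: is_derive_eq.
    by rewrite /GRing.scale /=; ring.
  apply: is_derive_eq.
  rewrite /GRing.scale /=.
  have d0 : n + N - 2 * r * cos x != 0 by rewrite gt_eqF// den0.
  have [n0 N0] : n != 0 /\ N != 0 by rewrite !gt_eqF.
  rewrite /poisson_den sin2cos2 (_ : (2 * r)^-1 = r / (2 * n * N)); last first.
    by rewrite -mulrA -rE; field.
  rewrite [X in _ - _ * X](_ : _ = (r * cos x - n) / (n + N - 2 * r * cos x)).
    have -> : 1 - cos x ^+ 2 = (2 * n * N - 2 * cos x ^+ 2 * r ^+ 2) / (2 * n * N).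
      by rewrite rE; field; rewrite n0 N0.
    by field; rewrite n0 d0 N0.
  have -> : 1 + (r * sin x / (N - r * cos x)) ^+ 2 =
      N * (n + N - 2 * r * cos x) / (N - r * cos x) ^+ 2.
    transitivity ((N ^+ 2 - 2 * N * r * cos x + r ^+ 2 * (cos x ^+ 2 + sin x ^+ 2))
      / (N - r * cos x) ^+ 2); first by field.
    by rewrite cos2Dsin2 rE; congr (_ / _); ring.
  have -> : r * sin x * (- (N - r * cos x) ^- 2 * (r * sin x)) +
      (N - r * cos x)^-1 * (r * cos x) =
      N * (r * cos x - n) / (N - r * cos x) ^+ 2.
    transitivity ((r * cos x * N - r ^+ 2 * (cos x ^+ 2 + sin x ^+ 2))
      / (N - r * cos x) ^+ 2); first by field.
    by rewrite cos2Dsin2 rE; congr (_ / _); ring.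
  by field; rewrite q0 d0 N0.
rewrite (Rintegral_FTC_oo (pi_gt0 R) dF).
  by rewrite /F sinpi sin0 !mulr0 !mul0r atan0 !mulr0 !addr0 !subr0.
move=> x; apply: cvgM.
  by apply: cvgM; exact: continuous_sin.
by apply: continuousV; [rewrite gt_eqF|exact: continuous_poisson_den].
Qed.

Lemma integrable_poisson_chebr rho k : mu.-integrable `]0, pi[
  (EFin \o (fun x =>
    sin x ^+ 2 * chebr (r ^+ 2) (2 * rho * cos x) k / poisson_den x)).
Proof.
have [M hM] := chebr_bounded (r ^+ 2) (`|2 * rho|) k.
apply: (@integrable_poisson (fun x => chebr (r ^+ 2) (2 * rho * cos x) k) M).
  apply: continuous_chebr => x.
  by apply: cvgM; [exact: cvg_cst|exact: continuous_cos].
by move=> x; apply: hM; exact: normr_cos_le1.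
Qed.

(** Multiplying a Chebyshev polynomial by the denominator gives a combination
    of its neighbours, so the integrals satisfy a linear recursion of order two,
    whose inhomogeneous term comes from [Rintegral_sin2_chebr]. Its solution is
    geometric, since e n is a root of the characteristic equation. The sign e = -1
    is needed for c and e = 1 for 1 - c. *)
Lemma Rintegral_poisson_chebr e k : e * e = 1 ->
  \int[mu]_(x in `]0, pi[)
    (sin x ^+ 2 * chebr (r ^+ 2) (2 * (e * r) * cos x) k.+1 / poisson_den x) =
  pi / (2 * N) * (e * n) ^+ k.
Proof.
move=> ee; set h := fun k x => sin x ^+ 2 * chebr (r ^+ 2) (2 * (e * r) * cos x) k.
have er0 : e * r != 0.
  by apply: mulf_neq0 => //; apply/eqP => e0; move/eqP: ee; rewrite e0 mul0r eq_sym oner_eq0.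
have er2 : r ^+ 2 = (e * r) ^+ 2 by rewrite exprMn [e ^+ 2]ee mul1r.
have ih := integrable_poisson_chebr (e * r).
have is0 k' : mu.-integrable `]0, pi[ (EFin \o (h k')).
  have [M hM] := chebr_bounded (r ^+ 2) (`|2 * (e * r)|) k'.
  apply: (integrable_0pi (M := M)).
    apply: measurable_funTS; apply: continuous_measurable_fun => x.
    apply: cvgM; first by apply: cvgM; exact: continuous_sin.
    apply: (@continuous_chebr _ (fun y => 2 * (e * r) * cos y)) => y.
    by apply: cvgM; [exact: cvg_cst|exact: continuous_cos].
  move=> x _; rewrite /h normrM -[leRHS]mul1r.
  rewrite ler_pM//; last by apply: hM; exact: normr_cos_le1.
  by rewrite ger0_norm ?sqr_ge0// sin2cos2 gerBl sqr_ge0.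
have rec k' : \int[mu]_(x in `]0, pi[) (h k'.+2 x / poisson_den x) =
    e * (n + N) * \int[mu]_(x in `]0, pi[) (h k'.+1 x / poisson_den x)
    - e * (if k' is 0 then pi / 2 else 0)
    - n * N * \int[mu]_(x in `]0, pi[) (h k' x / poisson_den x).
  have -> : (if k' is 0 then pi / 2 else 0) = \int[mu]_(x in `]0, pi[) h k'.+1 x.
    by rewrite -(Rintegral_sin2_chebr k' er0) -er2.
  rewrite (@eq_Rintegral _ _ _ mu _ (fun x => (e * (n + N) * (h k'.+1 x / poisson_den x)
      - e * h k'.+1 x) - n * N * (h k' x / poisson_den x))).
    rewrite RintegralB//; last 2 first.
    - rewrite (_ : EFin \o _ =
          (EFin \o (fun x => (e * (n + N) * (h k'.+1 x / poisson_den x))%R))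
          \- (EFin \o (fun x => (e * h k'.+1 x)%R)))%E; last by apply/funext.
      by apply: integrableB => //; apply: integrable_scale => //; exact: ih.
    - by apply: integrable_scale => //; exact: ih.
    rewrite RintegralB//; last by apply: integrable_scale => //; exact: is0.
      by rewrite !RintegralZl//; (exact: ih || exact: is0).
    by apply: integrable_scale => //; exact: ih.
  move=> x; rewrite inE/= in_itv/= => xpi.
  have := poisson_den_gt0 xpi.
  rewrite /h chebrSS /poisson_den => /lt0r_neq0.
  set c := chebr _ _ k'.+1; set c' := chebr _ _ k'; rewrite -rE => d0.
  have -> : e * (n + N) = e * (n + N - 2 * r * cos x) + (e * e) * (2 * (e * r) * cos x).
    rewrite ee; transitivity (e * (n + N) - 2 * e * r * cos x + 2 * (e * r) * cos x); ring.
  by rewrite ee; field.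
elim/nat_ind2: k => [||k IH0 IH1].
- by rewrite mulr1 /h; under eq_Rintegral do rewrite mulr1; rewrite Rintegral_poisson1.
- rewrite rec /h; under eq_Rintegral do rewrite mulr1.
  rewrite Rintegral_poisson1 (@eq_Rintegral _ _ _ mu _ (cst 0)); last first.
    by move=> x _; rewrite /= mulr0 mul0r.
  rewrite Rintegral_cst// mul0r mulr0 subr0 expr1.
  by field; rewrite gt_eqF.
- rewrite rec IH0 IH1 mulr0 subr0 !exprS.
  transitivity (pi / (2 * N) * (e * n) ^+ k * (e * e * n * (n + N) - n * N)); first ring.
  rewrite ee; transitivity (pi / (2 * N) * (e * n) ^+ k * ((e * e) * n * n)); last ring.
  by rewrite ee; ring.
Qed.

End PoissonKernel.
End Kernel.

(** * Integration against the absolutely continuous part *)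

(** If u and v are the two square roots, then 1 - u^2 - v^2 is the sum of a b
    and (1 - a)(1 - b), two numbers with the product u^2 v^2, and therefore is at
    least 2 u v. *)
Lemma sqrt_sum_le1 (R : realType) (a b : R) : 0 <= a <= 1 -> 0 <= b <= 1 ->
  Num.sqrt (b * (1 - a)) + Num.sqrt (a * (1 - b)) <= 1.
Proof.
move=> /andP[a0 a1] /andP[b0 b1].
have uE : Num.sqrt (b * (1 - a)) ^+ 2 = b * (1 - a).
  by rewrite sqr_sqrtr// mulr_ge0// subr_ge0.
have vE : Num.sqrt (a * (1 - b)) ^+ 2 = a * (1 - b).
  by rewrite sqr_sqrtr// mulr_ge0// subr_ge0.
have u0 := sqrtr_ge0 (b * (1 - a)); have v0 := sqrtr_ge0 (a * (1 - b)).
set u := Num.sqrt (b * _) in uE u0 *; set v := Num.sqrt (a * _) in vE v0 *.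
rewrite -(@ler_pXn2r _ 2) ?nnegrE ?addr_ge0// expr1n.
have : 2 * (u * v) <= 1 - u ^+ 2 - v ^+ 2.
  rewrite -(@ler_pXn2r _ 2) ?nnegrE ?mulr_ge0//; last first.
    rewrite uE vE; have := mulr_ge0 a0 b0.
    have : 0 <= (1 - a) * (1 - b) by rewrite mulr_ge0// subr_ge0.
    lra.
  rewrite exprMn exprMn uE vE; have := sqr_ge0 (a + b - 1); lra.
lra.
Qed.

Lemma nu_density_ge0 (R : realType) (a b t : R) : 0 <= t <= 2 ->
  0 <= nu_density a b t.
Proof.
move=> /andP[t0 t2].
by rewrite divr_ge0 ?sqrtr_ge0// !mulr_ge0 ?pi_ge0 ?subr_ge0.
Qed.

Section NuIntegral.
Variables (R : realType) (alpha beta : {i01 R}).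
Let a : R := alpha%:num.
Let b : R := beta%:num.
Local Notation mu := (@lebesgue_measure R).
Local Notation g := (nu_density a b).
Local Notation S := (nu_support a b).

Lemma nu_support_sub : S `<=` `[0, 2].
Proof.
have ab1 : Num.sqrt (b * (1 - a)) + Num.sqrt (a * (1 - b)) <= 1.
  by apply: sqrt_sum_le1; apply/andP; split; rewrite /a /b.
have u0 := sqrtr_ge0 (b * (1 - a)); have v0 := sqrtr_ge0 (a * (1 - b)).
rewrite /nu_support /gamma1 /gamma2 /gamma3 /gamma4.
move=> t /= []; rewrite !in_itv/= ?le_min ?ge_max.
  by move=> /and3P[*]; apply/andP; split; lra.
by move=> /andP[/andP[*] *]; apply/andP; split; lra.
Qed.

Let g_ge0 t : S t -> 0 <= g t.
Proof. by move=> /nu_support_sub; exact: nu_density_ge0. Qed.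

Let mS : measurable (S : set (measurableTypeR R)).
Proof. exact: measurable_nu_support. Qed.

Let mg : measurable_fun S (EFin \o g).
Proof. by apply/measurable_EFinP; apply: measurable_funTS; exact: measurable_nu_density. Qed.

Let integral_nu_indic (E : set (measurableTypeR R)) : measurable E ->
  (\int[nu alpha beta]_t (\1_E t)%:E = \int[mu]_(t in S) ((\1_E t)%:E * (g t)%:E))%E.
Proof.
move=> mE; rewrite integral_indic//= setIT /nu setIC integral_mkcondr.
apply: eq_integral => t tS; rewrite patchE indicE.
by case: (t \in E); rewrite ?mul1e ?mul0e.
Qed.

Import HBNNSimple.

Let integral_nu_nnsfun (h : {nnsfun (measurableTypeR R) >-> R}) :
  (\int[nu alpha beta]_t (h t)%:E = \int[mu]_(t in S) ((h t)%:E * (g t)%:E))%E.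
Proof.
under [LHS]eq_integral do rewrite fimfunE -fsumEFin//.
rewrite [LHS]ge0_integral_fsum//; last 2 first.
  - by move=> r; exact/measurable_EFinP/measurableT_comp.
  - by move=> n x _; rewrite EFinM nnfun_muleindic_ge0.
under [RHS]eq_integral.
  move=> x; rewrite inE => xS.
  rewrite muleC fimfunE -fsumEFin// ge0_mule_fsumr; last first.
    by move=> r; rewrite EFinM nnfun_muleindic_ge0.
  over.
rewrite [RHS]ge0_integral_fsum//; last 2 first.
  - move=> r; apply: emeasurable_funM => //.
    by apply/measurable_EFinP; do 2 apply/measurableT_comp => //.
  - move=> n x xS; rewrite mule_ge0//; first by rewrite lee_fin; exact: g_ge0.
    by rewrite EFinM nnfun_muleindic_ge0.
apply: eq_fsbigr => r _.
rewrite !integralZl_indic_nnsfun//= integral_nu_indic//.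
have [r0|r0] := leP 0 r; last first.
  rewrite preimage_nnfun0// indic0.
  under eq_integral do rewrite mul0e; under [RHS]eq_integral do rewrite mulr0 mule0.
  by rewrite integral0 mule0.
rewrite -ge0_integralZl//.
- by apply: eq_integral => t _; rewrite EFinM muleA muleC.
- by apply: emeasurable_funM => //; apply/measurable_EFinP; exact: measurable_indic.
- by move=> t tS; rewrite mule_ge0 ?lee_fin//; exact: g_ge0.
Qed.

(** The density formula for integrals of nonnegative functions, first for simple
    functions and then by monotone convergence. *)
Lemma ge0_integral_nu (f : measurableTypeR R -> R) :
  measurable_fun setT f -> (forall t, 0 <= f t) ->
  (\int[nu alpha beta]_t (f t)%:E = \int[mu]_(t in S) ((f t)%:E * (g t)%:E))%E.
Proof.
move=> /measurable_EFinP mf f0; pose f_ := nnsfun_approx measurableT mf.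
have f_cvg t : (f_ n t)%:E @[n --> \oo] --> (f t)%:E.
  apply: (@cvg_nnsfun_approx _ _ _ _ measurableT _ mf) => // x _.
  by rewrite lee_fin.
have f_nd t n m : (n <= m)%N -> f_ n t <= f_ m t.
  by move=> nm; exact/lefP/nd_nnsfun_approx.
transitivity (lim (\int[nu alpha beta]_t (f_ n t)%:E @[n --> \oo])%E).
  rewrite -monotone_convergence//=.
  - by apply: eq_integral => t _; apply/esym/cvg_lim => //; exact: f_cvg.
  - by move=> n; exact/measurable_EFinP/measurable_funTS.
  - by move=> n ? _; rewrite lee_fin.
  - by move=> t _ n m nm; rewrite lee_fin f_nd.
transitivity (lim (\int[mu]_(t in S) ((f_ n t)%:E * (g t)%:E) @[n --> \oo])%E).
  by congr (lim _); under eq_fun do rewrite integral_nu_nnsfun.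
rewrite -monotone_convergence//=.
- apply: eq_integral => t tS; apply/cvg_lim => //.
  by apply: cvgeMr => //; exact: f_cvg.
- move=> n; apply: emeasurable_funM => //.
  exact/measurable_EFinP/measurable_funTS.
- move=> n t tS; rewrite mule_ge0 ?lee_fin//; exact: g_ge0.
- by move=> t tS n m nm; rewrite lee_wpmul2r ?lee_fin ?f_nd//; exact: g_ge0.
Qed.

End NuIntegral.

(** * The angular parametrization of the support *)

Section NuAngle.
Variables (R : realType) (a b : R).
Hypotheses (a01 : 0 < a < 1) (b01 : 0 < b < 1).
Local Notation mu := (@lebesgue_measure R).
Local Notation g := (nu_density a b).
Local Notation S := (nu_support a b).

Let u : R := Num.sqrt (b * (1 - a)).
Let v : R := Num.sqrt (a * (1 - b)).
Let r : R := u * v.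

Let a0 : 0 < a. Proof. by case/andP: a01. Qed.
Let a1 : 0 < 1 - a. Proof. by case/andP: a01; rewrite subr_gt0. Qed.
Let b0 : 0 < b. Proof. by case/andP: b01. Qed.
Let b1 : 0 < 1 - b. Proof. by case/andP: b01; rewrite subr_gt0. Qed.
Let u0 : 0 < u. Proof. by rewrite sqrtr_gt0 mulr_gt0. Qed.
Let v0 : 0 < v. Proof. by rewrite sqrtr_gt0 mulr_gt0. Qed.
Let r0 : 0 < r. Proof. exact: mulr_gt0. Qed.
Let uE : u ^+ 2 = b * (1 - a). Proof. by rewrite sqr_sqrtr// mulr_ge0 ?ltW. Qed.
Let vE : v ^+ 2 = a * (1 - b). Proof. by rewrite sqr_sqrtr// mulr_ge0 ?ltW. Qed.

(** The value of (t - 1)^2 at the angle x. As x runs over ]0, pi[, its square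
    root decreases from sqrt U + sqrt V to their distance, that is, it describes
    the half of the support to the right of 1. *)
Definition angle_c (x : R) : R := b * (1 - a) + a * (1 - b) + 2 * r * cos x.

Let lo : R := `|u - v|.
Let hi : R := u + v.

Lemma angle_c_itv (x : R) : 0 < x < pi -> lo ^+ 2 < angle_c x < hi ^+ 2.
Proof.
move=> xpi; rewrite /angle_c -uE -vE /lo /hi real_normK ?num_real//.
have s0 : 0 < sin x ^+ 2 by rewrite exprn_gt0// sin_gt0_pi.
have c2 : cos x ^+ 2 < 1 by rewrite cos2sin2; lra.
have : `|cos x| < 1 by rewrite -(@expr_lt1 _ 2)// real_normK ?num_real.
rewrite ltr_norml => /andP[c1 c1'].
have h1 : 0 < r * (cos x + 1) by rewrite mulr_gt0//; lra.
have h2 : 0 < r * (1 - cos x) by rewrite mulr_gt0//; lra.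
by rewrite /r in h1 h2 *; apply/andP; split; lra.
Qed.

Let hi1 : hi <= 1.
Proof.
by apply: sqrt_sum_le1; [case/andP: a01|case/andP: b01] => /ltW -> /ltW ->.
Qed.

Lemma angle_c_gt0 (x : R) : 0 < x < pi -> 0 < angle_c x.
Proof. by move=> /angle_c_itv/andP[+ _]; apply: le_lt_trans; exact: sqr_ge0. Qed.

Lemma angle_c_lt1 (x : R) : 0 < x < pi -> angle_c x < 1.
Proof.
move=> /angle_c_itv/andP[_ h]; apply: lt_le_trans h _.
by rewrite expr_le1 ?hi1// addr_ge0 ?(ltW u0) ?(ltW v0).
Qed.

Lemma sqrt_angle_c_itv (x : R) : 0 < x < pi -> lo < Num.sqrt (angle_c x) < hi.
Proof.
move=> xpi; have /andP[h1 h2] := angle_c_itv xpi.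
have lo0 : 0 <= lo by exact: normr_ge0.
have hi0 : 0 <= hi by rewrite addr_ge0 ?ltW.
rewrite -(@ltr_pXn2r _ 2) ?nnegrE ?sqrtr_ge0//.
rewrite -[X in _ && X](@ltr_pXn2r _ 2) ?nnegrE ?sqrtr_ge0//.
by rewrite sqr_sqrtr ?h1// ltW// angle_c_gt0.
Qed.

(** The density of the image of one half of the measure in the angle
    variable. *)
Definition angle_weight (x : R) : R :=
  2 * r ^+ 2 * sin x ^+ 2 / (pi * (angle_c x * (1 - angle_c x))).

(** The product under the root in the density is
    - ((c - u^2 - v^2)^2 - 4 r^2), which is 4 r^2 sin^2 x. *)
Lemma nu_density_angle (x y : R) : 0 < x < pi -> y = Num.sqrt (angle_c x) ->
  g (1 + y) * (r * sin x / y) = angle_weight x /\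
  g (1 - y) * (r * sin x / y) = angle_weight x.
Proof.
move=> xpi yE.
have y2 : y ^+ 2 = angle_c x by rewrite yE sqr_sqrtr// ltW// angle_c_gt0.
have y0 : 0 < y by rewrite yE sqrtr_gt0 angle_c_gt0.
have sx : 0 < sin x by rewrite sin_gt0_pi.
have num : Num.sqrt (4 * r ^+ 2 * sin x ^+ 2) = 2 * r * sin x.
  have -> : 4 * r ^+ 2 * sin x ^+ 2 = (2 * r * sin x) ^+ 2 by ring.
  by rewrite sqrtr_sqr ger0_norm// !mulr_ge0// ltW.
have quart : - ((y ^+ 2 - u ^+ 2 - v ^+ 2) ^+ 2 - 4 * r ^+ 2) = 4 * r ^+ 2 * sin x ^+ 2.
  by rewrite y2 /angle_c uE vE sin2cos2; ring.
have c0 := angle_c_gt0 xpi; have c1 := angle_c_lt1 xpi.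
have yn0 : y != 0 by rewrite gt_eqF.
have yn1 : 1 - y ^+ 2 != 0 by rewrite y2 gt_eqF// subr_gt0.
have y1 : (1 + y) * (1 - y) != 0 by rewrite mulrC -subr_sqr expr1n.
have pi0 : pi != 0 :> R by rewrite gt_eqF// pi_gt0.
rewrite /nu_density /gamma1 /gamma2 /gamma3 /gamma4 -/u -/v /angle_weight -y2.
move: y1; rewrite mulf_eq0 => /norP[y1 y1'].
split.
- rewrite (_ : - (_ * _) = 4 * r ^+ 2 * sin x ^+ 2); last by rewrite -quart /r; ring.
  rewrite num (_ : `|1 + y - 1| = y); last by rewrite addrC addKr ger0_norm// ltW.
  rewrite (_ : 2 - (1 + y) = 1 - y); last ring.
  by move: (@pi R) pi0 => P P0; field; rewrite yn0 P0 yn1 y1 y1'.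
- rewrite (_ : - (_ * _) = 4 * r ^+ 2 * sin x ^+ 2); last by rewrite -quart /r; ring.
  rewrite num (_ : `|1 - y - 1| = y); last by rewrite addrC addKr normrN ger0_norm// ltW.
  rewrite (_ : 2 - (1 - y) = 1 + y); last ring.
  by move: (@pi R) pi0 => P P0; field; rewrite yn0 P0 yn1 y1 y1'.
Qed.

Lemma continuous_nu_density t : t != 0 -> t != 2 -> t != 1 ->
  {for t, continuous g}.
Proof.
move=> t0 t2 t1; have cB c : {for t, continuous (fun s : R => s - c)}.
  by apply: cvgB; [exact: cvg_id|exact: cvg_cst].
apply: cvgM.
  apply: continuous_comp; last exact: sqrt_continuous.
  by apply: cvgN; do 3!(apply: cvgM; last exact: cB); exact: cB.
apply: cvgV.
  rewrite !mulf_neq0 ?normr_eq0 ?subr_eq0//; last by rewrite eq_sym.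
  by rewrite gt_eqF// pi_gt0.
apply: cvgM; last first.
  by apply: cvg_norm; exact: cB.
apply: cvgM; last by apply: cvgB; [exact: cvg_cst|exact: cvg_id].
by apply: cvgM; [exact: cvg_cst|exact: cvg_id].
Qed.

Lemma integral_right_half (h : R -> R) :
  {in `](1 + lo), (1 + hi)[, continuous h} ->
  {in `](1 + lo), (1 + hi)[, forall t, 0 <= h t} ->
  (\int[mu]_(t in `](1 + lo)%R, (1 + hi)%R[) (h t)%:E =
   \int[mu]_(x in `]0%R, pi[)
     (h (1 + Num.sqrt (angle_c x)) * (r * sin x / Num.sqrt (angle_c x)))%:E)%E.
Proof.
move=> ch h0.
pose F' (x : R) : R := - (r * sin x / Num.sqrt (angle_c x)).
pose F (x : R) : R := 1 + Num.sqrt (angle_c x).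
have dF (x : R) : x \in `]0, pi[ -> is_derive x 1 F (F' x).
  rewrite in_itv/= => xpi; have c0 := angle_c_gt0 xpi.
  have dc : is_derive x 1 angle_c (- (2 * r * sin x)).
    rewrite /angle_c; apply: is_derive_eq; rewrite /GRing.scale /=; ring.
  have ds : is_derive (angle_c x) 1 Num.sqrt (2 * Num.sqrt (angle_c x))^-1.
    exact: is_derive1_sqrt.
  have dcomp := is_derive1_comp ds dc.
  apply: is_derive_eq; rewrite add0r /F' /GRing.scale /=.
  by field; rewrite gt_eqF// sqrtr_gt0.
rewrite (ge0_substitution_decreasing_oo (pi_gt0 R) dF _ _ ch h0).
- by apply: eq_integral => x _; rewrite /F' opprK.
- move=> x; rewrite in_itv/= => xpi; have c0 := angle_c_gt0 xpi.
  by rewrite oppr_lt0 divr_gt0 ?sqrtr_gt0// mulr_gt0// sin_gt0_pi.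
- move=> x; rewrite in_itv/= => xpi; have c0 := angle_c_gt0 xpi.
  apply: cvgN; apply: cvgM.
    by apply: cvgM; [exact: cvg_cst|exact: continuous_sin].
  apply: cvgV; first by rewrite gt_eqF// sqrtr_gt0.
  apply: continuous_comp; last exact: sqrt_continuous.
  apply: cvgD; first exact: cvg_cst.
  by apply: cvgM; [exact: cvg_cst|exact: continuous_cos].
- move=> x; rewrite !in_itv/= => /sqrt_angle_c_itv.
  by rewrite !ltrD2l.
- move=> t; rewrite in_itv/= => /andP[t1 t2].
  have lo0 : 0 <= lo by exact: normr_ge0.
  have lo2 : lo ^+ 2 = u ^+ 2 + v ^+ 2 - 2 * r.
    by rewrite real_normK ?num_real// /r; ring.
  have hi2 : hi ^+ 2 = u ^+ 2 + v ^+ 2 + 2 * r by rewrite /hi /r; ring.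
  have hi0 : 0 <= hi by rewrite addr_ge0 ?(ltW u0) ?(ltW v0).
  clearbody lo hi.
  have s1 : lo ^+ 2 < (t - 1) ^+ 2 by rewrite ltr_pXn2r ?nnegrE//; lra.
  have s2 : (t - 1) ^+ 2 < hi ^+ 2.
    by rewrite ltr_pXn2r ?nnegrE//; lra.
  pose y := ((t - 1) ^+ 2 - u ^+ 2 - v ^+ 2) / (2 * r).
  have r20 : 0 < 2 * r by rewrite mulr_gt0.
  have y1 : -1 < y < 1.
    by rewrite ltr_pdivlMr// ltr_pdivrMr//; apply/andP; split; lra.
  exists (acos y).
    rewrite in_itv/=; have /andP[y2 y3] := y1.
    by rewrite acos_gt0 ?acos_ltpi ?y2 ?y3 ?(ltW y2) ?(ltW y3).
  rewrite /F; have -> : angle_c (acos y) = (t - 1) ^+ 2.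
    have yin : y \in `[-1, 1].
      by rewrite in_itv/=; case/andP: y1 => /ltW -> /ltW ->.
    by rewrite /angle_c acosK// -uE -vE /y; field; rewrite gt_eqF.
  rewrite sqrtr_sqr ger0_norm; last lra.
  by rewrite addrC subrK.
Qed.

Lemma continuous_angle_c : continuous angle_c.
Proof.
move=> x; apply: cvgD; first exact: cvg_cst.
by apply: cvgM; [exact: cvg_cst|exact: continuous_cos].
Qed.

Lemma angle_weight_ge0 (x : R) : 0 < x < pi -> 0 <= angle_weight x.
Proof.
move=> xpi; have c0 := angle_c_gt0 xpi; have c1 := angle_c_lt1 xpi.
by rewrite divr_ge0 ?mulr_ge0 ?sqr_ge0 ?pi_ge0 ?subr_ge0 ?ltW// sin_gt0_pi.
Qed.

Lemma measurable_angle_weight : measurable_fun setT angle_weight.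
Proof.
apply: measurable_funM.
  apply: continuous_measurable_fun => x; apply: cvgM; first exact: cvg_cst.
  by apply: cvgM; exact: continuous_sin.
apply: measurableT_comp; first exact: measurable_invr.
apply: continuous_measurable_fun => x; apply: cvgM; first exact: cvg_cst.
apply: cvgM; first exact: continuous_angle_c.
by apply: cvgB; [exact: cvg_cst|exact: continuous_angle_c].
Qed.

Lemma integral_reflect (h : R -> R) (c d : R) : c < d ->
  {in `]c, d[, continuous h} -> {in `]c, d[, forall t, 0 <= h t} ->
  (\int[mu]_(t in `]c, d[) (h t)%:E =
   \int[mu]_(t in `](2 - d)%R, (2 - c)%R[) (h (2 - t))%:E)%E.
Proof.
move=> cd ch h0.
have dF (x : R) : x \in `]2 - d, 2 - c[ -> is_derive x 1 (fun t => 2 - t) (-1 : R).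
  by move=> _; apply: is_derive_eq; ring.
have cd' : 2 - d < 2 - c by lra.
rewrite (ge0_substitution_decreasing_oo cd' dF _ _ ch h0).
- by apply: eq_integral => x _; rewrite opprK mulr1.
- by move=> x _; rewrite oppr_lt0.
- by move=> x _; exact: cvg_cst.
- by move=> x; rewrite !in_itv/= => /andP[? ?]; apply/andP; split; lra.
- move=> y; rewrite in_itv/= => /andP[? ?]; exists (2 - y); last by ring.
  by rewrite in_itv/=; apply/andP; split; lra.
Qed.

(** The support is symmetric about 1, which is not visible on the gammas
    because of the minimum and the maximum. *)
Lemma gamma_sym : [/\ gamma1 a b = 1 - hi, gamma4 a b = 1 + hi,
  Num.min (gamma2 a b) (gamma3 a b) = 1 - lo &
  Num.max (gamma2 a b) (gamma3 a b) = 1 + lo].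
Proof.
rewrite /gamma1 /gamma2 /gamma3 /gamma4 -/u -/v /hi /lo; split; [ring|ring| |].
- have [uv|uv] := leP v u.
    by rewrite ger0_norm ?subr_ge0// min_l; lra.
  by rewrite ltr0_norm ?subr_lt0// min_r; lra.
- have [uv|uv] := leP v u.
    by rewrite ger0_norm ?subr_ge0// max_r; lra.
  by rewrite ltr0_norm ?subr_lt0// max_l; lra.
Qed.

(** Passing to open intervals makes the union disjoint even if both closed
    intervals contain 1. *)
Lemma integral_nu_support (h : R -> \bar R) : measurable_fun setT h ->
  (forall t, S t -> 0 <= h t)%E ->
  (\int[mu]_(t in S) h t = \int[mu]_(t in `](1 - hi)%R, (1 - lo)%R[) h t +
     \int[mu]_(t in `](1 + lo)%R, (1 + hi)%R[) h t)%E.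
Proof.
move=> mh h0; have [g1 g4 g2 g3] := gamma_sym.
have lo0 : 0 <= lo by exact: normr_ge0.
have SE : (((S `\ (1 - hi)) `\ (1 - lo)) `\ (1 + lo)) `\ (1 + hi) =
   `](1 - hi)%R, (1 - lo)%R[%classic `|` `](1 + lo)%R, (1 + hi)%R[%classic.
  rewrite /nu_support g1 g2 g3 g4; apply/seteqP; split => t /=; rewrite !in_itv/=.
    move=> [[[[h1 /eqP n1] /eqP n2] /eqP n3] /eqP n4].
    case: h1 => /andP[t1 t2]; [left|right].
      by rewrite !lt_neqAle t1 t2 n2 eq_sym n1.
    by rewrite !lt_neqAle t1 t2 n4 eq_sym n3.
  case=> /andP[t1 t2]; (split; [split; [split; [split|]|]|]).
  all: try by move=> tE; rewrite tE in t1 t2; lra.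
  - by left; rewrite !ltW.
  - by right; rewrite !ltW.
have subS : `](1 - hi)%R, (1 - lo)%R[%classic `|` `](1 + lo)%R, (1 + hi)%R[%classic `<=` S.
  by rewrite -SE => t [[[[]]]].
rewrite -ge0_integral_setU//; last 3 first.
- exact: measurable_funTS.
- by move=> t /subS; exact: h0.
- rewrite disj_set2E; apply/eqP/seteqP; split => t //=; rewrite !in_itv/=.
  by move=> [/andP[? ?] /andP[? ?]]; lra.
have mS : measurable (S : set (measurableTypeR R)) by exact: measurable_nu_support.
rewrite -SE !integral_setD1//; try exact: measurable_funTS.
all: by repeat apply: measurableD.
Qed.

Lemma integral_nu_angle (f : R -> R) : continuous f ->
  (forall t, 0 <= t <= 2 -> 0 <= f t) ->
  (\int[mu]_(t in S) ((f t)%:E * (g t)%:E) = \int[mu]_(x in `]0%R, pi[)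
     ((f (1 + Num.sqrt (angle_c x)) + f (1 - Num.sqrt (angle_c x)))
       * angle_weight x)%:E)%E.
Proof.
move=> cf f0.
have lo0 : 0 <= lo by exact: normr_ge0.
have lohi : lo < hi.
  by have := u0; have := v0; rewrite /lo /hi ltr_norml => ? ?; apply/andP; split; lra.
pose h t := f t * g t.
have h0 t : 0 <= t <= 2 -> 0 <= h t by move=> t02; rewrite mulr_ge0 ?f0 ?nu_density_ge0.
have mh : measurable_fun setT h.
  apply: measurable_funM; first exact: continuous_measurable_fun.
  exact: measurable_nu_density.
have cfor t : t != 0 -> t != 2 -> t != 1 -> {for t, continuous h}.
  by move=> ? ? ?; apply: cvgM; [exact: cf|exact: continuous_nu_density].
have h_left : {in `]1 - hi, 1 - lo[, continuous h}.
  move=> t; rewrite in_itv/= => /andP[? ?]; apply: cfor.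
  - by rewrite gt_eqF//; have := hi1; lra.
  - by rewrite lt_eqF//; lra.
  - by rewrite lt_eqF//; lra.
have h_right : {in `]1 + lo, 1 + hi[, continuous h}.
  move=> t; rewrite in_itv/= => /andP[? ?]; apply: cfor.
  - by rewrite gt_eqF//; lra.
  - by rewrite lt_eqF//; have := hi1; lra.
  - by rewrite gt_eqF//; lra.
have h_left0 : {in `]1 - hi, 1 - lo[, forall t, 0 <= h t}.
  move=> t; rewrite in_itv/= => /andP[? ?]; apply: h0.
  by have := hi1 => ?; apply/andP; split; lra.
have h_right0 : {in `]1 + lo, 1 + hi[, forall t, 0 <= h t}.
  move=> t; rewrite in_itv/= => /andP[? ?]; apply: h0.
  by have := hi1 => ?; apply/andP; split; lra.
transitivity (\int[mu]_(t in S) (h t)%:E)%E;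
  first by apply: eq_integral => t _; rewrite EFinM.
rewrite integral_nu_support; last 2 first.
- exact/measurable_EFinP.
- rewrite /nu_support; have [-> -> -> ->] := gamma_sym.
  move=> t /=; rewrite !in_itv/= lee_fin => tS; apply: h0.
  by have := hi1 => ?; case: tS => /andP[? ?]; apply/andP; split; lra.
rewrite integral_reflect//; last lra.
have -> : 2 - (1 - lo) = 1 + lo by ring.
have -> : 2 - (1 - hi) = 1 + hi by ring.
rewrite (@integral_right_half (fun t => h (2 - t))); last 2 first.
- move=> t; rewrite in_itv/= => /andP[? ?].
  have c2 : (2 - s : R) @[s --> t] --> (2 - t : R).
    by apply: cvgB; [exact: cvg_cst|exact: cvg_id].
  apply: (cvg_comp _ _ c2).
  by apply: h_left; rewrite in_itv/=; apply/andP; split; lra.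
- move=> t; rewrite in_itv/= => /andP[? ?].
  by apply: h_left0; rewrite in_itv/=; apply/andP; split; lra.
rewrite integral_right_half//.
have E1 x : x \in `]0, pi[ ->
    h (2 - (1 + Num.sqrt (angle_c x))) * (r * sin x / Num.sqrt (angle_c x)) =
    f (1 - Num.sqrt (angle_c x)) * angle_weight x.
  rewrite in_itv/= => xpi; have [_ <-] := nu_density_angle xpi erefl.
  by rewrite (_ : 2 - (1 + _) = 1 - Num.sqrt (angle_c x)) ; [rewrite /h -mulrA|ring].
have E2 x : x \in `]0, pi[ ->
    h (1 + Num.sqrt (angle_c x)) * (r * sin x / Num.sqrt (angle_c x)) =
    f (1 + Num.sqrt (angle_c x)) * angle_weight x.
  rewrite in_itv/= => xpi; have [<- _] := nu_density_angle xpi erefl.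
  by rewrite /h -mulrA.
transitivity (\int[mu]_(x in `]0%R, pi[) (f (1 - Num.sqrt (angle_c x)) * angle_weight x)%:E +
  \int[mu]_(x in `]0%R, pi[) (f (1 + Num.sqrt (angle_c x)) * angle_weight x)%:E)%E.
  by congr (_ + _)%E; apply: eq_integral => x; rewrite inE => xpi; rewrite ?E1 ?E2.
have sqrt_le1 x : 0 < x < pi -> 0 <= Num.sqrt (angle_c x) <= 1.
  move=> /sqrt_angle_c_itv/andP[? ?]; rewrite sqrtr_ge0 /=.
  by have := hi1; lra.
have msqrt : measurable_fun setT (fun x => Num.sqrt (angle_c x)).
  apply: continuous_measurable_fun => x.
  apply: continuous_comp; last exact: sqrt_continuous.
  exact: continuous_angle_c.
rewrite -ge0_integralD//.
- by apply: eq_integral => x _; rewrite -EFinD addrC mulrDl.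
- move=> x /=; rewrite in_itv/= => xpi; rewrite lee_fin mulr_ge0 ?angle_weight_ge0//.
  by apply: f0; have := sqrt_le1 _ xpi; lra.
- apply/measurable_EFinP; apply: measurable_funTS; apply: measurable_funM.
    apply: measurableT_comp; first exact: continuous_measurable_fun.
    by apply: measurable_funB.
  exact: measurable_angle_weight.
- move=> x /=; rewrite in_itv/= => xpi; rewrite lee_fin mulr_ge0 ?angle_weight_ge0//.
  by apply: f0; have := sqrt_le1 _ xpi; lra.
- apply/measurable_EFinP; apply: measurable_funTS; apply: measurable_funM.
    apply: measurableT_comp; first exact: continuous_measurable_fun.
    by apply: measurable_funD.
  exact: measurable_angle_weight.
Qed.

End NuAngle.

(** * Angular moments *)

Section AngleMoments.
Variables (R : realType) (a b : R).
Hypotheses (a01 : 0 < a < 1) (b01 : 0 < b < 1).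
Local Notation mu := (@lebesgue_measure R).

Let U : R := b * (1 - a).
Let V : R := a * (1 - b).
Let U' : R := a * b.
Let V' : R := (1 - a) * (1 - b).
Let r : R := Num.sqrt (b * (1 - a)) * Num.sqrt (a * (1 - b)).
Let c (x : R) : R := angle_c a b x.
Let s k (x : R) : R := chebr (U * V) (2 * r * cos x) k.

Let a0 : 0 < a. Proof. by case/andP: a01. Qed.
Let a1 : 0 < 1 - a. Proof. by case/andP: a01; rewrite subr_gt0. Qed.
Let b0 : 0 < b. Proof. by case/andP: b01. Qed.
Let b1 : 0 < 1 - b. Proof. by case/andP: b01; rewrite subr_gt0. Qed.
Let U0 : 0 < U. Proof. exact: mulr_gt0. Qed.
Let V0 : 0 < V. Proof. exact: mulr_gt0. Qed.
Let U'0 : 0 < U'. Proof. exact: mulr_gt0. Qed.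
Let V'0 : 0 < V'. Proof. exact: mulr_gt0. Qed.
Let r2 : r ^+ 2 = U * V. Proof. by rewrite exprMn !sqr_sqrtr// ltW. Qed.

Let minmaxM (x y : R) : Num.min x y * Num.max x y = x * y.
Proof. by have [xy|xy] := leP x y => //; rewrite mulrC. Qed.
Let minmaxD (x y : R) : Num.min x y + Num.max x y = x + y.
Proof. by have [xy|xy] := leP x y => //; rewrite addrC. Qed.

Let n1 := Num.min U V.
Let N1 := Num.max U V.
Let n2 := Num.min U' V'.
Let N2 := Num.max U' V'.
Let n10 : 0 < n1. Proof. by rewrite lt_min U0. Qed.
Let n20 : 0 < n2. Proof. by rewrite lt_min U'0. Qed.
Let nN1 : n1 <= N1. Proof. by rewrite ge_min le_max lexx. Qed.
Let nN2 : n2 <= N2. Proof. by rewrite ge_min le_max lexx. Qed.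
Let rE1 : (- r) ^+ 2 = n1 * N1. Proof. by rewrite sqrrN r2 minmaxM. Qed.
Let rE2 : r ^+ 2 = n2 * N2. Proof. by rewrite r2 minmaxM /U /V /U' /V'; ring. Qed.

Let c_den x : c x = poisson_den n1 N1 (- r) x.
Proof. by rewrite /c /angle_c /poisson_den minmaxD -/r /U /V; ring. Qed.
Let c_den' x : 1 - c x = poisson_den n2 N2 r x.
Proof. by rewrite /c /angle_c /poisson_den minmaxD -/r /U' /V'; ring. Qed.

(** Partial fractions: 1 / (c (1 - c)) = 1 / c + 1 / (1 - c), two
    Poisson denominators. *)
Lemma angle_weight_split (x h : R) : 0 < x < pi -> h * angle_weight a b x =
  2 * r ^+ 2 / pi * (sin x ^+ 2 * h / poisson_den n1 N1 (- r) x) +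
  2 * r ^+ 2 / pi * (sin x ^+ 2 * h / poisson_den n2 N2 r x).
Proof.
move=> xpi; rewrite -c_den -c_den' /angle_weight -/r -/(c x).
have cn : c x != 0 by rewrite gt_eqF// angle_c_gt0.
have cn1 : 1 - c x != 0 by rewrite gt_eqF// subr_gt0 angle_c_lt1.
have : pi != 0 :> R by rewrite gt_eqF// pi_gt0.
by move: (@pi R) => P P0; field; rewrite P0 cn cn1.
Qed.

Lemma integrable_angle (h : R -> R) (M : R) : continuous h ->
  (forall x, `|h x| <= M) ->
  mu.-integrable `]0, pi[ (EFin \o (fun x => h x * angle_weight a b x)).
Proof.
move=> ch hM; apply: (@eq_integrable _ _ _ mu `]0, pi[ _ (EFin \o (fun x =>
  2 * r ^+ 2 / pi * (sin x ^+ 2 * h x / poisson_den n1 N1 (- r) x) +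
  2 * r ^+ 2 / pi * (sin x ^+ 2 * h x / poisson_den n2 N2 r x)))) => //.
  by move=> x; rewrite inE/= in_itv/= => xpi; rewrite angle_weight_split.
by apply: integrable_add => //; apply: integrable_scale => //;
  exact: (integrable_poisson _ _ _ ch hM).
Qed.

Let continuous_s k : continuous (s k).
Proof.
apply: continuous_chebr => x.
by apply: cvgM; [exact: cvg_cst|exact: continuous_cos].
Qed.

Let integrable_cs n k : mu.-integrable `]0, pi[
  (EFin \o (fun x => c x ^+ n * s k x * angle_weight a b x)).
Proof.
have [M hM] := chebr_bounded (U * V) (`|2 * r|) k.
apply: (@integrable_angle _ ((`|U + V| + `|2 * r|) ^+ n * M)).
  move=> x; apply: cvgM; last exact: continuous_s.
  have cc : {for x, continuous c} by exact: continuous_angle_c.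
  elim: n => [|n IHn]; first by under eq_fun do rewrite expr0; exact: cvg_cst.
  by rewrite exprS; under eq_fun do rewrite exprS; exact: cvgM.
move=> x; have h2 := normr_cos_le1 (2 * r) x.
rewrite normrM normrX ler_pM ?exprn_ge0//; last exact: hM.
apply: lerXn2r; rewrite ?nnegrE// ?addr_ge0//.
by rewrite /c /angle_c; apply: le_trans (ler_normD _ _) _; rewrite lerD2l.
Qed.

Definition angle_moment n k : R :=
  \int[mu]_(x in `]0, pi[) (c x ^+ n * s k x * angle_weight a b x).

Lemma angle_moment0 n : angle_moment n 0 = 0.
Proof.
rewrite /angle_moment /s /=; under eq_Rintegral do rewrite mulr0 mul0r.
by rewrite Rintegral_cst// mul0r.
Qed.

Lemma angle_moment_rec n k : angle_moment n.+1 k.+1 =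
  angle_moment n k.+2 + (U + V) * angle_moment n k.+1 + (U * V) * angle_moment n k.
Proof.
pose F n k x := c x ^+ n * s k x * angle_weight a b x.
rewrite /angle_moment (@eq_Rintegral _ _ _ mu _ (fun x =>
  (F n k.+2 x + (U + V) * F n k.+1 x) + U * V * F n k x)); last first.
  move=> x _; rewrite /F /s chebrSS exprS {1}/c /angle_c -/r -/U -/V; ring.
have iF k' : mu.-integrable `]0, pi[ (EFin \o F n k') by exact: integrable_cs.
rewrite RintegralD//; last exact: integrable_scale.
  rewrite RintegralD//; last exact: integrable_scale.
  by rewrite !RintegralZl.
by apply: integrable_add => //; exact: integrable_scale.
Qed.

(** The prefactor 2 r^2 / pi times pi / (2 N) is r^2 / N = n, for both
    kernels. *)
Lemma angle_moment_cheb k :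
  angle_moment 0 k.+1 = n1 * (- n1) ^+ k + n2 ^+ k.+1.
Proof.
rewrite /angle_moment (@eq_Rintegral _ _ _ mu _ (fun x =>
  2 * r ^+ 2 / pi * (sin x ^+ 2 * s k.+1 x / poisson_den n1 N1 (- r) x) +
  2 * r ^+ 2 / pi * (sin x ^+ 2 * s k.+1 x / poisson_den n2 N2 r x))); last first.
  by move=> x; rewrite inE/= in_itv/= => xpi; rewrite expr0 mul1r angle_weight_split.
have [M hM] := chebr_bounded (U * V) (`|2 * r|) k.+1.
have sM x : `|s k.+1 x| <= M by apply: hM; exact: normr_cos_le1.
have i1 := integrable_poisson n10 nN1 rE1 (@continuous_s k.+1) sM.
have i2 := integrable_poisson n20 nN2 rE2 (@continuous_s k.+1) sM.
rewrite RintegralD//; [|exact: integrable_scale|exact: integrable_scale].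
rewrite !RintegralZl//.
have -> : \int[mu]_(x in `]0, pi[) (sin x ^+ 2 * s k.+1 x / poisson_den n1 N1 (- r) x) =
    pi / (2 * N1) * (- n1) ^+ k.
  have e1 : -1 * -1 = 1 :> R by rewrite mulrNN mulr1.
  have := Rintegral_poisson_chebr n10 nN1 rE1 k e1.
  by rewrite (sqrrN r) mulrNN mul1r mulN1r r2.
have -> : \int[mu]_(x in `]0, pi[) (sin x ^+ 2 * s k.+1 x / poisson_den n2 N2 r x) =
    pi / (2 * N2) * n2 ^+ k.
  have := Rintegral_poisson_chebr n20 nN2 rE2 k (mulr1 1).
  by rewrite !mul1r r2.
have N10 : N1 != 0 by rewrite gt_eqF// (lt_le_trans n10).
have N20 : N2 != 0 by rewrite gt_eqF// (lt_le_trans n20).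
have pi0 : pi != 0 :> R by rewrite gt_eqF// pi_gt0.
rewrite {1}(_ : r ^+ 2 = n1 * N1); last by rewrite -rE1 sqrrN.
rewrite rE2 exprS.
by move: (@pi R) pi0 => P P0; field; rewrite N10 N20 P0.
Qed.

(** The odd powers of the square root cancel between the two halves. *)
Lemma integral_angle_pow k :
  (\int[mu]_(x in `]0%R, pi[)
    (((1 + Num.sqrt (c x)) ^+ k + (1 - Num.sqrt (c x)) ^+ k)
      * angle_weight a b x)%:E)%E =
  (\sum_(i < k.+1) (if odd i then 0 else 2 * angle_moment i./2 1) *+ 'C(k, i))%:E.
Proof.
pose G i x := (if odd i then 0 else 2) *+ 'C(k, i) *
  (c x ^+ i./2 * s 1 x * angle_weight a b x).
transitivity (\int[mu]_(x in `]0%R, pi[) \sum_(i < k.+1) (G i x)%:E)%E.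
  apply: eq_integral => x; rewrite inE/= in_itv/= => xpi.
  have y2 : Num.sqrt (c x) ^+ 2 = c x by rewrite sqr_sqrtr// ltW// angle_c_gt0.
  rewrite sumEFin; congr EFin.
  move: (Num.sqrt (c x)) y2 => y y2.
  rewrite ![1 + _]addrC !exprD1n -big_split/= mulr_suml.
  apply: eq_bigr => i _; rewrite /G /s /= mulr1 -y2 -exprM mulrA; congr (_ * _).
  rewrite -mulrnDl mulrnAl; congr (_ *+ _); rewrite exprNn.
  rewrite -signr_odd; have := odd_double_half i; rewrite -mul2n.
  case: (odd i) => iE; first by rewrite mul0r expr1 mulN1r subrr.
  by rewrite add0n in iE; rewrite iE expr0 mul1r mulr2n mulrDl !mul1r.
have iG i : mu.-integrable `]0, pi[ (EFin \o G i).
  by apply: integrable_scale => //; exact: integrable_cs.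
rewrite integral_sum//; last by move=> i; exact: iG.
have <- := @sumEFin R _ (index_enum _) xpredT (fun i : 'I_k.+1 =>
  (if odd i then 0 else 2 * angle_moment i./2 1) *+ 'C(k, i)).
apply: eq_bigr => i _.
rewrite -[LHS]fineK; last exact: integrable_fin_num (iG i).
congr EFin; rewrite -[LHS]/(Rintegral _ _ _) /G RintegralZl//.
by rewrite -/(angle_moment _ _); case: (odd i); rewrite ?mul0rn ?mul0r// mulrnAl.
Qed.

End AngleMoments.

(** * Moments of the measure *)

Section NuMoments.
Variables (R : realType) (alpha beta : {i01 R}).
Let a : R := alpha%:num.
Let b : R := beta%:num.
Let U : R := b * (1 - a).
Let V : R := a * (1 - b).
Let U' : R := a * b.
Let V' : R := (1 - a) * (1 - b).
Local Notation mu := (@lebesgue_measure R).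
Local Notation g := (nu_density a b).
Local Notation S := (nu_support a b).

Lemma i01_itv (x : {i01 R}) : 0 <= x%:num <= 1.
Proof. by apply/andP; split. Qed.

Lemma degenerate_nu_support : U * V = 0 -> mu S = 0%E.
Proof.
move=> UV0; have [g1 g4 g2 g3] := gamma_sym a b.
rewrite /nu_support g1 g2 g3 g4.
have -> : `|Num.sqrt (b * (1 - a)) - Num.sqrt (a * (1 - b))| =
    Num.sqrt (b * (1 - a)) + Num.sqrt (a * (1 - b)).
  move/eqP: UV0; rewrite mulf_eq0 /U /V => /orP[/eqP ->|/eqP ->].
    by rewrite sqrtr0 !add0r normrN ger0_norm.
  by rewrite sqrtr0 subr0 addr0 ger0_norm.
rewrite !set_itv1; apply/eqP; rewrite -measure_le0.
by apply: le_trans (measureU2 _ _ _) _ => //; rewrite /= !lebesgue_measure_set1 adde0.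
Qed.

(** The entry T n k is the integral of c^n T_k against nu. The array is zero
    when alpha or beta is 0 or 1: both intervals of the support are then points and the
    minima in the formula vanish as well. *)
Lemma nu_moments : exists T : nat -> nat -> R,
  [/\ forall n, T n 0%N = 0,
      forall n k, T n.+1 k.+1 = T n k.+2 + (U + V) * T n k.+1 + U * V * T n k,
      forall k, T 0%N k.+1 = 2 * (Num.min U V * (- Num.min U V) ^+ k
                                  + Num.min U' V' ^+ k.+1) &
      forall k, (\int[mu]_(t in S) ((t ^+ k)%:E * (g t)%:E) =
        (\sum_(i < k.+1) (if odd i then 0 else T i./2 1) *+ 'C(k, i))%:E)%E].
Proof.
have /andP[a0 a1] := i01_itv alpha; have /andP[b0 b1] := i01_itv beta.
rewrite -/a in a0 a1; rewrite -/b in b0 b1.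
have [U0 V0] : 0 <= U /\ 0 <= V by rewrite !mulr_ge0// subr_ge0.
have [U'0 V'0] : 0 <= U' /\ 0 <= V' by rewrite !mulr_ge0// subr_ge0.
have [UV0|UV0] := eqVneq (U * V) 0.
  have min0 (x y : R) : 0 <= x -> 0 <= y -> x * y = 0 -> Num.min x y = 0.
    move=> x0 y0 /eqP; rewrite mulf_eq0 => /orP[/eqP ->|/eqP ->].
      by rewrite min_l.
    by rewrite min_r.
  exists (fun _ _ => 0); split => //.
  - by move=> n k; rewrite !mulr0 !addr0.
  - move=> k; rewrite !min0 ?mul0r ?expr0n ?addr0 ?mulr0//.
    by rewrite -UV0 /U /V /U' /V'; ring.
  - move=> k; rewrite null_set_integral//.
    + by rewrite big1// => i _; case: ifP => _; rewrite mul0rn.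
    + exact: measurable_nu_support.
    + apply: emeasurable_funM; apply/measurable_EFinP; apply: measurable_funTS.
        exact: exprn_measurable.
      exact: measurable_nu_density.
    + exact: degenerate_nu_support.
have a01 : 0 < a < 1.
  rewrite !lt_neqAle a0 a1 !andbT; apply/andP; split; apply/eqP => E.
    by move: UV0; rewrite /V -E mul0r mulr0 eqxx.
  by move: UV0; rewrite /U E subrr mulr0 mul0r eqxx.
have b01 : 0 < b < 1.
  rewrite !lt_neqAle b0 b1 !andbT; apply/andP; split; apply/eqP => E.
    by move: UV0; rewrite /U -E mul0r mul0r eqxx.
  by move: UV0; rewrite /V E subrr mulr0 mulr0 eqxx.
exists (fun n k => 2 * angle_moment a b n k); split.
- by move=> n; rewrite angle_moment0 mulr0.
- by move=> n k; rewrite (angle_moment_rec a01 b01) -/U -/V; ring.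
- by move=> k; rewrite (angle_moment_cheb a01 b01).
- move=> k; rewrite (@integral_nu_angle _ _ _ a01 b01 (fun t => t ^+ k)).
  + exact: integral_angle_pow.
  + exact: exprn_continuous.
  + by move=> t /andP[t0 _]; rewrite exprn_ge0.
Qed.

(** The sums U + V', U + U', V + V' and V + U' are 1 - a, b, 1 - b and a. *)
Lemma min_masses :
  Num.min U V + Num.min U' V' = Num.min (Num.min a b) (Num.min (1 - a) (1 - b)).
Proof.
have UVE : V - U = a - b by rewrite /U /V; ring.
have UVE' : U' - V' = a + b - 1 by rewrite /U' /V'; ring.
have e1 : U + V' = 1 - a by rewrite /U /V'; ring.
have e2 : U + U' = b by rewrite /U /U'; ring.
have e3 : V + V' = 1 - b by rewrite /V /V'; ring.
have e4 : V + U' = a by rewrite /V /U'; ring.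
have [h1|h1] := leP U V; have [h2|h2] := leP U' V'.
- rewrite (min_r (x := a)); last lra.
  by rewrite (min_l (x := 1 - a)) ?min_l; lra.
- rewrite (min_r (x := a)); last lra.
  by rewrite (min_l (x := 1 - a)) ?min_r; lra.
- rewrite (min_l (x := a)); last lra.
  by rewrite (min_r (x := 1 - a)) ?min_l; lra.
- rewrite (min_l (x := a)); last lra.
  by rewrite (min_r (x := 1 - a)) ?min_r; lra.
Qed.

Lemma nu_mass : nu alpha beta setT =
  (2 * Num.min (Num.min a b) (Num.min (1 - a) (1 - b)))%:E.
Proof.
have [T [_ _ T0 TE]] := nu_moments.
transitivity (\int[mu]_(t in S) ((t ^+ 0)%:E * (g t)%:E))%E.
  by rewrite /nu setTI; apply: eq_integral => t _; rewrite expr0 mul1e.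
by rewrite TE big_ord1 /= T0 expr0 mulr1 expr1 min_masses.
Qed.

End NuMoments.

Section LawMoments.
Variable R : realType.
Local Notation mR := (measurableTypeR R).
Implicit Types m : {measure set mR -> \bar R}.

(** On the whole line an odd power changes sign; cutting it off outside [0, 2],
    where the measures live, makes the additivity of the integral
    of nonnegative functions in the measure applicable. *)
Definition pow_supp (k : nat) (t : mR) : R := (t : R) ^+ k * \1_(`[0, 2]%classic) t.

Lemma pow_supp_ge0 k t : 0 <= pow_supp k t.
Proof.
rewrite /pow_supp indicE; case: (boolP (t \in _)) => [|_]; last by rewrite mulr0.
by rewrite inE/= in_itv/= => /andP[t0 _]; rewrite mulr1 exprn_ge0.
Qed.

Lemma measurable_pow_supp k : measurable_fun setT (pow_supp k).
Proof.
apply: measurable_funM; first exact: exprn_measurable.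
by apply: measurable_indic; exact: measurable_itv.
Qed.

Lemma integral_pow_supp m k : m (~` `[0, 2]%classic) = 0%E ->
  (\int[m]_t (t ^+ k)%:E = \int[m]_t (pow_supp k t)%:E)%E.
Proof.
move=> m0; apply: ae_eq_integral => //.
- by apply/measurable_EFinP; exact: exprn_measurable.
- by apply/measurable_EFinP; exact: measurable_pow_supp.
exists (~` `[0, 2]%classic); split => //.
  by apply: measurableC; exact: measurable_itv.
move=> t /=; apply: contra_not => t02 _.
by rewrite /pow_supp indicE mem_set ?mulr1.
Qed.

Lemma integral_pow_supp_dirac (c : {nonneg R}) (x : mR) k : 0 <= x <= 2 ->
  (\int[mscale c \d_x]_t (pow_supp k t)%:E = (c%:num * x ^+ k)%:E)%E.
Proof.
move=> x02; rewrite ge0_integral_mscale//; last 2 first.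
- by apply/measurable_EFinP; exact: measurable_pow_supp.
- by move=> t _; rewrite lee_fin pow_supp_ge0.
rewrite integral_dirac//; last by apply/measurable_EFinP; exact: measurable_pow_supp.
rewrite diracT mul1e /pow_supp indicE mem_set ?mulr1 ?EFinM//.
Qed.

Lemma mscale_dirac_supp (c : {nonneg R}) (x : mR) : 0 <= x <= 2 ->
  mscale c \d_x (~` `[0, 2]%classic : set mR) = 0%E.
Proof.
by move=> x02; rewrite /mscale /= diracE memNset ?mule0//; exact.
Qed.

Lemma integral_pow_supp_add m1 m2 k :
  (\int[measure_add m1 m2]_t (pow_supp k t)%:E =
   \int[m1]_t (pow_supp k t)%:E + \int[m2]_t (pow_supp k t)%:E)%E.
Proof.
rewrite ge0_integral_measure_add//.
- by move=> t _; rewrite lee_fin pow_supp_ge0.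
- by apply/measurable_EFinP; exact: measurable_pow_supp.
Qed.

Lemma measure_add_eq0 m1 m2 (A : set mR) : m1 A = 0%E -> m2 A = 0%E ->
  measure_add m1 m2 A = 0%E.
Proof. by move=> h1 h2; rewrite measure_addE h1 h2 adde0. Qed.

Lemma bernoulli_supp (x : {i01 R}) : bernoulli x (~` `[0, 2]%classic) = 0%E.
Proof. by apply: measure_add_eq0; apply: mscale_dirac_supp; lra. Qed.

Lemma bernoulli_moment (x : {i01 R}) k :
  \int[bernoulli x]_t (t ^+ k) = x%:num + (1 - x%:num) * 0 ^+ k.
Proof.
rewrite /Rintegral integral_pow_supp; last exact: bernoulli_supp.
rewrite integral_pow_supp_add !integral_pow_supp_dirac ?lexx ?ler0n//; last lra.
by rewrite /= expr1n mulr1.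
Qed.

Lemma total_mass_of_moment m : \int[m]_t (t ^+ 0) = 1 :> R -> m setT = 1%E.
Proof.
rewrite /Rintegral; under eq_integral do rewrite expr0.
rewrite integral_cst//= mul1e; case: (m setT) => //= [x ->//||].
  by move=> /esym/eqP; rewrite oner_eq0.
by move=> /esym/eqP; rewrite oner_eq0.
Qed.

End LawMoments.

Section TheLaw.
Variables (R : realType) (alpha beta : {i01 R}).
Let a : R := alpha%:num.
Let b : R := beta%:num.
Let U : R := b * (1 - a).
Let V : R := a * (1 - b).
Let U' : R := a * b.
Let V' : R := (1 - a) * (1 - b).
Local Notation mR := (measurableTypeR R).

Definition free_bernoulli_law : {measure set mR -> \bar R} :=
  measure_add
    (measure_add
      (measure_add
        (mscale (Num.max (1 - alpha%:num - beta%:num) 0)%:nng \d_(0 : mR))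
        (mscale `|alpha%:num - beta%:num|%:nng \d_(1 : mR)))
      (mscale (Num.max (alpha%:num + beta%:num - 1) 0)%:nng \d_(2 : mR)))
    (nu alpha beta).

Lemma nu_supp : nu alpha beta (~` `[0, 2]%classic) = 0%E.
Proof.
rewrite /nu (_ : _ `&` _ = set0) ?integral_set0//.
by apply/seteqP; split => t //= [+ /nu_support_sub].
Qed.

Lemma free_bernoulli_law_supp : free_bernoulli_law (~` `[0, 2]%classic) = 0%E.
Proof.
by do 3?[apply: measure_add_eq0]; first [exact: nu_supp|apply: mscale_dirac_supp; lra].
Qed.

Lemma integral_nu_pow k :
  (\int[nu alpha beta]_t (pow_supp k t)%:E = \int[lebesgue_measure]_(t in nu_support a b)
     ((t ^+ k)%:E * (nu_density a b t)%:E))%E.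
Proof.
rewrite ge0_integral_nu; [|exact: measurable_pow_supp|exact: pow_supp_ge0].
apply: eq_integral => t; rewrite inE => /nu_support_sub t02.
by rewrite /pow_supp indicE mem_set// mulr1.
Qed.

(** The Chebyshev recursion with the characteristic roots x and y. *)
Lemma chebr_diff (x y : R) k :
  (x - y) * chebr (x * y) (x + y) k = x ^+ k - y ^+ k.
Proof.
elim/nat_ind2: k => [||k IH0 IH1]; first by rewrite mulr0 subrr.
  by rewrite mulr1 !expr1.
rewrite chebrSS mulrBr mulrCA IH1 mulrCA IH0 !exprS; ring.
Qed.

(** The arrays G false and G true contain the integrals of c^n T_k and of
    c^n T_k (t - 1). Only the atoms at 0 and 2 contribute to the second one,
    because nu and the atom at 1 are symmetric about 1. *)
Lemma free_bernoulli_law_moment : exists G : bool -> nat -> nat -> R,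
  [/\ forall e n, G e n 0%N = 0,
      forall e n k,
        G e n.+1 k.+1 = G e n k.+2 + (U + V) * G e n k.+1 + U * V * G e n k,
      forall k, G false 0%N k = cheb_mean a b k,
      forall k, G true 0%N k = U' ^+ k - V' ^+ k &
      forall k, (\int[free_bernoulli_law]_t (t ^+ k))%R =
        \sum_(i < k.+1) G (odd i) i./2 1%N *+ 'C(k, i)].
Proof.
have [T [T0 Trec Tmean TE]] := nu_moments alpha beta.
rewrite -/a -/b -/U -/V in Trec; rewrite -/a -/b -/U -/V -/U' -/V' in Tmean.
pose w0 : R := Num.max (1 - a - b) 0; pose w1 : R := `|a - b|.
pose w2 : R := Num.max (a + b - 1) 0.
have D' : U * V = U' * V' by rewrite /U /V /U' /V'; ring.
have m' : 1 - (U + V) = U' + V' by rewrite /U /V /U' /V'; ring.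
pose c1 k := chebr (U * V) (1 - (U + V)) k.
pose c0 k := chebr (U * V) (- (U + V)) k.
have c1E k : (U' - V') * c1 k = U' ^+ k - V' ^+ k.
  by rewrite /c1 D' m' chebr_diff.
have c0E k : (V - U) * c0 k = (- U) ^+ k - (- V) ^+ k.
  rewrite -chebr_diff mulrNN opprK [- U + V]addrC; congr (_ * chebr _ _ _).
  by rewrite opprD.
exists (fun e n k => if e then (w2 - w0) * c1 k
  else (w0 + w2) * c1 k + w1 * 0 ^+ n * c0 k + T n k); split.
- by case=> n; rewrite /c1 /c0 /= ?T0 !mulr0 ?addr0.
- case=> n k; cbv beta match; rewrite /c1 /c0 !chebrSS.
    ring.
  rewrite Trec exprS; ring.
- move=> k; rewrite expr0 mulr1 /cheb_mean -/U -/V -/U' -/V'.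
  case: k => [|k]; first by rewrite /c1 /c0 /= T0 !expr0; ring.
  rewrite Tmean.
  have UVE : a - b = V - U by rewrite /U /V; ring.
  have UVE' : a + b - 1 = U' - V' by rewrite /U' /V'; ring.
  have UVE'' : 1 - a - b = - (U' - V') by rewrite /U' /V'; ring.
  have -> : w1 * c0 k.+1 = - (- Num.max U V) ^+ k.+1 + (- Num.min U V) ^+ k.+1.
    rewrite /w1 UVE; have [h|h] := leP U V.
      by rewrite ger0_norm ?subr_ge0// c0E addrC.
    by rewrite ltr0_norm ?subr_lt0// mulNr c0E opprB addrC.
  have -> : (w0 + w2) * c1 k.+1 = Num.max U' V' ^+ k.+1 - Num.min U' V' ^+ k.+1.
    rewrite /w0 /w2 UVE' UVE''; have [h|h] := leP U' V'.
      rewrite max_l ?oppr_ge0 ?subr_le0// max_r ?subr_le0// addr0.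
      by rewrite mulNr c1E opprB.
    by rewrite max_r ?oppr_le0 ?subr_ge0 ?ltW// max_l ?subr_ge0 ?ltW// add0r c1E.
  have [h1|h1] := leP U V; have [h2|h2] := leP U' V'; rewrite !exprS; ring.
- move=> k; rewrite -c1E; congr (_ * _).
  rewrite /w0 /w2; have -> : U' - V' = a + b - 1 by rewrite /U' /V'; ring.
  by have [h|h] := leP (a + b - 1) 0; have [h'|h'] := leP (1 - a - b) 0; lra.
- move=> k; rewrite /Rintegral integral_pow_supp; last exact: free_bernoulli_law_supp.
  rewrite !integral_pow_supp_add !integral_pow_supp_dirac; try lra.
  rewrite integral_nu_pow TE -!EFinD /= -/a -/b -/w0 -/w1 -/w2.
  rewrite expr0n expr1n [in 2 ^+ k](_ : 2 = 1 + 1 :> R)// exprD1n.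
  have -> : (k == 0)%:R = (-1 + 1) ^+ k :> R by rewrite addNr expr0n.
  have -> : w1 * 1 = w1 * (0 + 1) ^+ k by rewrite add0r expr1n.
  rewrite !exprD1n !mulr_sumr -!big_split /=; apply: eq_bigr => i _.
  rewrite /c1 /c0 /= expr1n !mulr1 !mulrnAr -!mulrnDl; congr (_ *+ _).
  rewrite -signr_odd; have := odd_double_half i; case: (odd i) => iE.
    by rewrite -iE add1n expr0n /=; ring.
  rewrite (_ : 0 ^+ i = 0 ^+ i./2) ?expr0; first ring.
  by rewrite !expr0n -{1}iE add0n double_eq0.
Qed.

End TheLaw.

(** * The free sum of the projections *)

Section FreeSumMoments.
Variables (R : realType) (alpha beta : {i01 R}) (A : starProbSpace R) (p q : A).
Hypothesis pq_free : free_bernoulli_projections alpha beta p q.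
Local Open Scope complex_scope.
Let a : R := alpha%:num.
Let b : R := beta%:num.
Let ac : R[i] := a%:C.
Let bc : R[i] := b%:C.
Let x : A := p + q - 1.

Lemma free_mean : state A p = ac /\ state A q = bc.
Proof.
case: pq_free => _ _ [_ _ _ /(_ 1%N)] + [_ _ _ /(_ 1%N)] + _.
by rewrite !expr1 !bernoulli_moment !expr1 !mulr0 !addr0.
Qed.

Lemma cheb_mean_real k : cheb_mean ac bc k = (cheb_mean a b k)%:C.
Proof.
rewrite /cheb_mean /ac /bc.
by rewrite !(rmorphB, rmorphD, rmorphXn, rmorphN, rmorphM, rmorph1).
Qed.

(** The state and the measure give arrays with the same recursion and the same
    first row; then both sides are expanded in powers of (p + q) - 1 and t - 1. *)
Lemma free_sum_moment k :
  state A ((p + q) ^+ k) = (\int[free_bernoulli_law alpha beta]_t (t ^+ k))%:C.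
Proof.
have [G [G0 Grec Geven Godd ->]] := free_bernoulli_law_moment alpha beta.
rewrite -/a -/b in Grec Geven Godd.
case: (pq_free) => -[_ pp] [_ qq] _ _ fpq.
have [phip phiq] := free_mean.
have w0 := free_word fpq phip phiq.
pose T := cheb (centered p q ac bc) (lin_coef ac bc) (variance ac bc).
pose m := bc * (1 - ac) + ac * (1 - bc).
pose D := bc * (1 - ac) * (ac * (1 - bc)).
have xT j : x * x * T j.+1 = T j.+2 + m *: T j.+1 + D *: T j by exact: sqr_cheb.
have xTx j : x * x * (T j.+1 * x) = T j.+2 * x + m *: (T j.+1 * x) + D *: (T j * x).
  rewrite mulrA xT; move: (T j.+2) (T j.+1) (T j) => t2 t1 t0.
  by rewrite !mulrDl -!scalerAl.
have mE : m = (b * (1 - a) + a * (1 - b))%:C.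
  by rewrite !(rmorphB, rmorphD, rmorphM, rmorph1).
have DE : D = (b * (1 - a) * (a * (1 - b)))%:C.
  by rewrite !(rmorphB, rmorphD, rmorphM, rmorph1).
have Gc e n j : (G e n.+1 j.+1)%:C =
    (G e n j.+2)%:C + m * (G e n j.+1)%:C + D * (G e n j)%:C.
  by rewrite Grec !(rmorphD, rmorphM) /= mE DE !(rmorphD, rmorphM).
have evenE n j : state A ((x * x) ^+ n * T j) = (G false n j)%:C.
  apply: (cheb_array_ext (m := m) (D := D)
    (F := fun n j => state A ((x * x) ^+ n * T j)) (G := fun n j => (G false n j)%:C)).
  - move=> n' j'; rewrite exprSr -mulrA xT.
    move: (_ ^+ n') (T j'.+2) (T j'.+1) (T j') => y t2 t1 t0.
    by rewrite !mulrDr -!scalerAr !linearD !linearZ.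
  - exact: Gc.
  - by move=> n'; rewrite mulr0 linear0.
  - by move=> n'; rewrite G0.
  - move=> j'; rewrite expr0 mul1r Geven -cheb_mean_real.
    by have [] := phi_cheb pp qq (state1 A) w0 j'.
have oddE n j : state A ((x * x) ^+ n * (T j * x)) = (G true n j)%:C.
  apply: (cheb_array_ext (m := m) (D := D)
    (F := fun n j => state A ((x * x) ^+ n * (T j * x))) (G := fun n j => (G true n j)%:C)).
  - move=> n' j'; rewrite exprSr -mulrA xTx.
    move: (_ ^+ n') (T j'.+2 * x) (T j'.+1 * x) (T j' * x) => y t2 t1 t0.
    by rewrite !mulrDr -!scalerAr !linearD !linearZ.
  - exact: Gc.
  - by move=> n'; rewrite mul0r mulr0 linear0.
  - by move=> n'; rewrite G0.
  - move=> j'; rewrite expr0 mul1r Godd.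
    rewrite (phi_cheb_x pp qq (state1 A) w0).
    by rewrite !(rmorphB, rmorphXn, rmorphM, rmorph1).
have -> : p + q = x + 1 by rewrite subrK.
rewrite exprD1n !linear_sum /= rmorph_sum.
apply: eq_bigr => i _; rewrite linearMn rmorphMn /=; congr (_ *+ _).
have := odd_double_half i; case: (odd i) => iE.
  by rewrite -oddE mul1r -{1}iE addnC addn1 exprSr -mul2n exprM expr2.
by rewrite -evenE mulr1 -{1}iE add0n -mul2n exprM expr2.
Qed.

End FreeSumMoments.

Lemma bernoulli_distribution (R : realType) (A : starProbSpace R) (p : A)
    (x : {i01 R}) : projection p -> state A p = (x%:num)%:C%C ->
  has_distribution p (bernoulli x).
Proof.
move=> [sp pp] phip; split => //.
- by apply: total_mass_of_moment; rewrite bernoulli_moment expr0 mulr1 addrC subrK.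
- exists `[0, 2]%classic; split; first exact: segment_compact.
  exact: bernoulli_supp.
- case=> [|k]; rewrite bernoulli_moment.
    by rewrite !expr0 (state1 A) mulr1 addrC subrK rmorph1.
  have -> : p ^+ k.+1 = p by elim: k => [//|k IH]; rewrite exprS IH.
  by rewrite phip exprS mul0r mulr0 addr0.
Qed.

Lemma exists_free_bernoulli_projections (R : realType) (alpha beta : {i01 R}) :
  exists (A : starProbSpace R) (p q : A), free_bernoulli_projections alpha beta p q.
Proof.
exists (fock R), (fock_p alpha%:num), (fock_q beta%:num).
have a01 := i01_itv alpha; have b01 := i01_itv beta.
split; [exact: fock_p_proj|exact: fock_q_proj| | |exact: fock_free].
- apply: bernoulli_distribution; first exact: fock_p_proj.
  exact: fock_p_mean beta%:num.
- apply: bernoulli_distribution; first exact: fock_q_proj.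
  exact: fock_q_mean alpha%:num _.
Qed.

Unset Implicit Arguments.

Theorem theorem4 (R : realType) (alpha beta : {i01 R}) :
  is_bernoulli_free_conv alpha beta
    (measure_add
      (measure_add
        (measure_add
          (mscale (Num.max (1 - alpha%:num - beta%:num) 0)%:nng \d_(0 : measurableTypeR R))
          (mscale `|alpha%:num - beta%:num|%:nng \d_(1 : measurableTypeR R)))
        (mscale (Num.max (alpha%:num + beta%:num - 1) 0)%:nng \d_(2 : measurableTypeR R)))
      (nu alpha beta)) /\
  nu alpha beta setT =
    (2 * Num.min (Num.min alpha%:num beta%:num)
                 (Num.min (1 - alpha%:num) (1 - beta%:num)))%:E.
Proof.
split; last exact: nu_mass.
split; first exact: exists_free_bernoulli_projections.
move=> A p q pq; split.
- case: pq => -[sp _] [sq _] _ _ _.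
  by rewrite /selfadjoint starD sp sq.
- apply: (total_mass_of_moment (m := free_bernoulli_law alpha beta)).
  have := free_sum_moment pq 0; rewrite expr0 (state1 A).
  by move=> /eqP; rewrite eq_complex /= => /andP[/eqP].
- exists `[0, 2]%classic; split; first exact: segment_compact.
  exact: free_bernoulli_law_supp.
- exact: free_sum_moment.
Qed.
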